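(* The set $\mathrm{Mon}=\{X\in \mathrm{SF}\mid X\text{ is a Montel space}\}$ is a complete coanalytic subset of $\mathrm{SF}$. In particular, $\mathrm{Mon}$ is not analytic.
   Context: A Fréchet space is a completely metrizable locally convex topological vector space (real scalars) whose topology can be defined by an invariant metric; equivalently, it is complete and its topology is generated by a sequence of pseudonorms (seminorms). A subset $K$ of a Fréchet space is bounded if for every neighborhood $U$ of $0$ there is $a\in\mathbb{R}$ with $K\subseteq aU$. A Fréchet space is a Montel space if all of its closed bounded subsets are compact (Heine--Borel property). $C(\mathbb{R})$ is the Fréchet space of continuous real-valued functions on $\mathbb{R}$ with the topology of uniform convergence on compact sets; every separable Fréchet space is isomorphic to a closed subspace of it. For a Polish space $M$, $\mathcal{F}(M)$ is the set of nonempty closed subsets of $M$ with the Effros Borel structure, the $\sigma$-algebra generated by the sets $\{F\in\mathcal{F}(M)\mid F\cap U\neq\emptyset\}$, $U\subseteq M$ open; it is a standard Borel space. $\mathrm{SF}=\{X\subseteq C(\mathbb{R})\mid X\text{ is a closed vector subspace}\}$ with the $\sigma$-algebra generated by the sets $\{X\in\mathrm{SF}\mid X\cap U\neq\emptyset\}$, $U\subseteq C(\mathbb{R})$ open; it is a standard Borel space. A subset $A$ of a standard Borel space $S$ is $\Pi^1_1$-hard if for every Polish space $Z$ and every coanalytic $B\subseteq Z$ there is a Borel map $f\colon Z\to S$ with $f^{-1}(A)=B$; it is complete coanalytic if it is coanalytic and $\Pi^1_1$-hard. *)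

(* Defs.v *)
From HB Require Import structures.
From mathcomp Require Import all_boot all_order all_algebra.
From mathcomp Require Import all_classical all_reals all_analysis.

Set Implicit Arguments.
Unset Strict Implicit.
Unset Printing Implicit Defensive.

Import Order.TTheory GRing.Theory Num.Theory.
Import numFieldNormedType.Exports.

Local Open Scope classical_set_scope.
Local Open Scope ring_scope.

Section Metrizability.
Context {R : realType} {T : topologicalType}.
Implicit Type d : T -> T -> R.

Record is_metric d : Prop := IsMetric {
  metric_refl : forall x, d x x = 0 ;
  metric_eq : forall x y, d x y = 0 -> x = y ;
  metric_symm : forall x y, d x y = d y x ;
  metric_trian : forall x y z, d x z <= d x y + d y z }.

Definition metrizes d :=
  is_metric d /\
  forall (x : T) (A : set T),
    nbhs x A <-> exists2 e : R, 0 < e & [set y | d x y < e] `<=` A.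

Definition cauchy_seq d (u : nat -> T) :=
  forall e : R, 0 < e -> exists N, forall m n,
    (N <= m)%N -> (N <= n)%N -> d (u m) (u n) < e.

(* For [d] with [metrizes d], convergence for [d] is convergence in [T]. *)
Definition complete_metric d :=
  forall u : nat -> T, cauchy_seq d u -> exists l : T, u @ \oo --> l.

End Metrizability.

Definition completely_metrizable (R : realType) (T : topologicalType) :=
  exists d : T -> T -> R, metrizes d /\ complete_metric d.

Definition separable (T : topologicalType) :=
  exists2 D : set T, countable D & dense D.

Definition polish (R : realType) (T : topologicalType) :=
  separable T /\ completely_metrizable R T.

Section FrechetMontel.
Context {R : realType} (E : topologicalLmodType R).

Definition locally_convex_space :=
  exists2 B : set (set E), (forall b, b \in B -> convex_set b) & basis B.

Definition invariant_metric (d : E -> E -> R) :=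
  forall x y z : E, d (x + z) (y + z) = d x y.

Definition frechet_space :=
  [/\ locally_convex_space,
      completely_metrizable R E &
      exists d : E -> E -> R, metrizes d /\ invariant_metric d].

Definition bounded_subset (K : set E) :=
  forall U : set E, nbhs 0 U -> exists a : R, K `<=` [set a *: u | u in U].

Definition montel_space :=
  frechet_space /\
  forall K : set E, closed K -> bounded_subset K -> compact K.

End FrechetMontel.

Lemma initial_cont (S T : topologicalType) (W : choiceType) (f : W -> T)
    (g : S -> initial_topology f) :
  continuous (f \o g) -> continuous g.
Proof.
move=> cfg; apply/continuousP => _ [B oB <-].
by rewrite -comp_preimage; move/continuousP: cfg; exact.
Qed.

Lemma near_fst (S T : topologicalType) (p : S * T) (P : set S) :
  nbhs p.1 P -> \forall x \near p, P x.1.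
Proof.
by move=> Pp; exists (P, setT) => [|x []//]; split => //; exact: filterT.
Qed.

Lemma near_snd (S T : topologicalType) (p : S * T) (P : set T) :
  nbhs p.2 P -> \forall x \near p, P x.2.
Proof.
by move=> Pp; exists (setT, P) => [|x []//]; split => //; exact: filterT.
Qed.

(* A closed vector subspace [X] of [E] is first of all a set; [subspace_type X]
   is the corresponding topological vector space. *)
Record closed_subspace (R : realType) (E : topologicalLmodType R) :=
  ClosedSubspace {
    subspace_set :> set E ;
    subspace_closed : closed subspace_set ;
    subspace_submod : submod_closed [in subspace_set] }.

Section ClosedSubspaceType.
Context {R : realType} {E : topologicalLmodType R}.

HB.instance Definition _ := gen_eqMixin (closed_subspace E).
HB.instance Definition _ := gen_choiceMixin (closed_subspace E).

Lemma setT_submod_closed : submod_closed [in [set: E]].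
Proof. by split=> [|a u v _ _]; rewrite inE. Qed.

HB.instance Definition _ := isPointed.Build (closed_subspace E)
  (ClosedSubspace (@closedT E) setT_submod_closed).

Variable X : closed_subspace E.

Definition subspace_pred : {pred E} := [in subspace_set X].

HB.instance Definition _ :=
  GRing.isSubmodClosed.Build R E subspace_pred (subspace_submod X).

Definition subspace_type : Type := {x : E | x \in subspace_pred}.

HB.instance Definition _ := SubChoice.on subspace_type.
HB.instance Definition _ := [SubChoice_isSubLmodule of subspace_type by <:].
HB.instance Definition _ := Topological.copy subspace_type
  (initial_topology (val : subspace_type -> E)).

Lemma subspace_val_continuous : continuous (val : subspace_type -> E).
Proof. exact: initial_continuous. Qed.

Lemma subspace_add_continuous :
  continuous (fun x : subspace_type * subspace_type => x.1 + x.2).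
Proof.
apply: initial_cont.
have -> : val \o (fun x : subspace_type * subspace_type => x.1 + x.2) =
    (fun x : E * E => x.1 + x.2) \o (fun x => (val x.1, val x.2)).
  apply/funext => x; exact: (raddfD (val : subspace_type -> E)).
move=> x; apply: continuous_comp; last exact: add_continuous.
apply: cvg_pair.
  by apply: cvg_comp; [exact: cvg_fst|exact: subspace_val_continuous].
by apply: cvg_comp; [exact: cvg_snd|exact: subspace_val_continuous].
Qed.

Lemma subspace_scale_continuous :
  continuous (fun z : R^o * subspace_type => z.1 *: z.2).
Proof.
apply: initial_cont.
have -> : val \o (fun z : R^o * subspace_type => z.1 *: z.2) =
    (fun z : R^o * E => z.1 *: z.2) \o (fun z => (z.1, val z.2)).
  apply/funext => x; exact: (linearZZ (val : subspace_type -> E)).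
move=> x; apply: continuous_comp; last exact: scale_continuous.
apply: (@cvg_pair _ _ _ _ (nbhs (x.1 : R^o)) (nbhs (val x.2)));
  first exact: cvg_fst.
by apply: cvg_comp; [exact: cvg_snd|exact: subspace_val_continuous].
Qed.

HB.instance Definition _ :=
  PreTopologicalNmodule_isTopologicalNmodule.Build subspace_type
    subspace_add_continuous.
HB.instance Definition _ :=
  TopologicalNmodule_isTopologicalLmodule.Build R subspace_type
    subspace_scale_continuous.

End ClosedSubspaceType.

(* A copy of [continuousType R R], which has no canonical topology. *)
Definition Creal (R : realType) : Type := continuousType R R.

Section Creal.
Variable R : realType.

Definition contp : {pred R -> R} := mem [set f : R -> R | continuous f].

Section Sub.
Context (f : R -> R) (fP : f \in contp).
#[local] HB.instance Definition _ := @isContinuous.Build R R f (set_mem fP).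
Definition Creal_Sub : Creal R := (f : continuousType R R).
End Sub.

Lemma Creal_rect (K : Creal R -> Type) :
  (forall f (Pf : f \in contp), K (Creal_Sub Pf)) -> forall u, K u.
Proof.
move=> Ksub [f [[Pf]]]/=.
have := Ksub f (mem_set Pf); rewrite /Creal_Sub.
by congr K; congr Continuous.Pack; congr Continuous.Class;
  congr isContinuous.Axioms_; exact: Prop_irrelevance.
Qed.

Lemma Creal_valP f (Pf : f \in contp) :
  ((Creal_Sub Pf : continuousType R R) : R -> R) = f.
Proof. by []. Qed.

HB.instance Definition _ := isSub.Build (R -> R) contp (Creal R)
  Creal_rect Creal_valP.
HB.instance Definition _ := [Choice of Creal R by <:].

Lemma contp_submod_closed : submod_closed contp.
Proof.
split=> [|a f g]; rewrite !inE/=; first by move=> x; exact: cvg_cst.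
by move=> cf cg x; apply: cvgD; [apply: cvgM; [exact: cvg_cst|exact: cf]|exact: cg].
Qed.

HB.instance Definition _ :=
  GRing.isSubmodClosed.Build R (R -> R) contp contp_submod_closed.
HB.instance Definition _ := [SubChoice_isSubLmodule of Creal R by <:].
HB.instance Definition _ := Topological.copy (Creal R)
  (initial_topology (val : Creal R -> {family compact, R -> R})).

Lemma Creal_near (f : Creal R) (K : set R) (e : R) : compact K -> 0 < e ->
  \forall g \near f, forall t, K t -> `|val f t - val g t| < e.
Proof.
move=> cK e0.
have entE : entourage [set xy : R * R | `|xy.1 - xy.2| < e].
  exact: (entourage_ball R (PosNum e0)).
have := @fam_nbhs _ _ compact _ _ (val f) entE cK.
exact: (@initial_continuous (Creal R) {family compact, R -> R} val f).
Qed.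

Lemma Creal_cvg (T : Type) (F : set_system T) (h : T -> Creal R) (f : Creal R) :
  Filter F ->
  (forall (K : set R) (e : R), compact K -> 0 < e ->
    \forall x \near F, forall t, K t -> `|val f t - val (h x) t| < e) ->
  h @ F --> f.
Proof.
move=> FF hf.
have cvgv : {family compact, (val \o h) @ F --> (val f : R -> R)}.
  apply/fam_cvgP => K cK A /uniform_nbhs [E [entE EA]].
  have [e /= e0 eE] : exists2 e : R, 0 < e & [set xy | ball xy.1 e xy.2] `<=` E.
    by move: entE; rewrite -entourage_ballE.
  apply: filterS (hf K e cK e0) => x hx; apply: EA => t Kt; apply: eE.
  exact: hx.
move=> A [_ [[B oB <-] Bf BA]].
have FB : F ((val \o h) @^-1` B) := cvgv B (open_nbhs_nbhs (conj oB Bf)).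
exact: (@filterS _ F FF _ (h @^-1` A) (fun x Bx => BA (h x) Bx) FB).
Qed.

Lemma Creal_addE (f g : Creal R) t : val (f + g) t = val f t + val g t.
Proof. by rewrite (raddfD (val : Creal R -> (R -> R))). Qed.

Lemma Creal_scaleE (a : R) (f : Creal R) t : val (a *: f) t = a * val f t.
Proof. by rewrite (linearZZ (val : Creal R -> (R -> R))). Qed.

Lemma Creal_add_continuous :
  continuous (fun x : Creal R * Creal R => x.1 + x.2).
Proof.
move=> p; apply: Creal_cvg => K e cK e0.
have e20 : 0 < e / 2 by rewrite divr_gt0.
have := near_snd (Creal_near p.2 cK e20).
have := near_fst (Creal_near p.1 cK e20).
apply: filterS2 => x x1 x2 t Kt.
rewrite !Creal_addE opprD addrACA.
rewrite (le_lt_trans (ler_normD _ _))// [ltRHS]splitr ltrD//; first exact: x1.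
exact: x2.
Qed.

Lemma Creal_scale_continuous :
  continuous (fun z : R^o * Creal R => z.1 *: z.2).
Proof.
move=> p; apply: Creal_cvg => K e cK e0; set a := p.1; set f := p.2.
have [M M0 fM] : exists2 M : R, 0 < M & forall t, K t -> `|val f t| <= M.
  have cf : {within K, continuous (val f : R -> R)}.
    apply: continuous_subspaceT.
    exact: (@cts_fun _ _ (f : continuousType R R)).
  have [M [_ fM]] := compact_bounded (continuous_compact cf cK).
  exists (`|M| + 1) => [|t Kt]; first by rewrite ltr_wpDl.
  apply: fM; first by rewrite (le_lt_trans (ler_norm M))// ltrDl.
  by exists t.
have a1 : 0 < `|a| + 1 by rewrite ltr_wpDl.
have eM : 0 < Num.min 1 (e / 2 / M) by rewrite lt_min ltr01/= !divr_gt0.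
have ea : 0 < e / 2 / (`|a| + 1) by rewrite !divr_gt0.
have := near_snd (Creal_near f cK ea : nbhs p.2 _).
have := near_fst (nbhsx_ballx (a : R^o) _ eM : nbhs p.1 _).
apply: filterS2 => z; rewrite /ball/= lt_min => /andP[az1 azM] zf t Kt.
change (`|val ((a : R) *: f) t - val ((z.1 : R) *: z.2) t| < e).
rewrite !Creal_scaleE.
have -> : a * val f t - z.1 * val z.2 t =
    (a - z.1) * val f t + z.1 * (val f t - val z.2 t).
  by rewrite mulrBl mulrBr addrA subrK.
rewrite (le_lt_trans (ler_normD _ _))// [ltRHS]splitr ltrD// normrM.
  rewrite (@le_lt_trans _ _ (`|a - z.1| * M))//.
    by rewrite ler_wpM2l// fM.
  by rewrite -ltr_pdivlMr.
have z1 : `|z.1| <= `|a| + 1.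
  rewrite -[z.1](subrK a) addrC (le_trans (ler_normD _ _))// lerD2l.
  by rewrite distrC ltW.
rewrite (@le_lt_trans _ _ ((`|a| + 1) * `|val f t - val z.2 t|))//.
  by rewrite ler_wpM2r.
by rewrite mulrC -ltr_pdivlMr//; exact: zf.
Qed.

HB.instance Definition _ :=
  PreTopologicalNmodule_isTopologicalNmodule.Build (Creal R)
    Creal_add_continuous.
HB.instance Definition _ :=
  TopologicalNmodule_isTopologicalLmodule.Build R (Creal R)
    Creal_scale_continuous.

End Creal.

(* The generating family of the Effros sigma-algebra. *)
Definition hit_sets (R : realType) (E : topologicalLmodType R) :
    set (set (closed_subspace E)) :=
  [set [set X : closed_subspace E | (X : set E) `&` U !=set0]
    | U in [set U : set E | open U]].

Definition SF (R : realType) := g_sigma_algebraType (@hit_sets R (Creal R)).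

Definition Mon (R : realType) : set (SF R) :=
  [set X : closed_subspace (Creal R) | montel_space (subspace_type X)].
Arguments Mon R : clear implicits.

(* [T] is not required to be a [measurableType], as Polish spaces may be
   empty. *)
Definition borel_map (T : topologicalType) (d : measure_display)
    (S : measurableType d) (f : T -> S) :=
  forall A : set S, measurable A -> <<s [set U : set T | open U] >> (f @^-1` A).

Section Projective.
Variable R : realType.

(* Subsets of a Polish space: continuous images of Polish spaces. *)
Definition polish_analytic (Z : topologicalType) (A : set Z) : Prop :=
  exists2 Y : topologicalType, polish R Y &
    exists2 f : Y -> Z, continuous f & range f = A.

Definition polish_coanalytic (Z : topologicalType) (A : set Z) :=
  polish_analytic (~` A).

Section StandardBorel.
Context {d : measure_display} {S : measurableType d}.
Implicit Type A : set S.

(* Subsets of a standard Borel space, which carries no distinguished topology: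
   Borel images of Polish spaces. *)
Definition analytic A : Prop :=
  exists2 Y : topologicalType, polish R Y &
    exists2 f : Y -> S, borel_map f & range f = A.

Definition coanalytic A := analytic (~` A).

Definition pi11_hard A :=
  forall Z : topologicalType, polish R Z ->
  forall B : set Z, polish_coanalytic B ->
    exists2 f : Z -> S, borel_map f & f @^-1` A = B.

Definition complete_coanalytic A := coanalytic A /\ pi11_hard A.

End StandardBorel.
End Projective.

(* Main.v *)
Require Import Defs.
From mathcomp Require Import all_boot all_order all_algebra.
From mathcomp Require Import all_classical all_reals all_analysis.
From HB Require Import structures.
From mathcomp Require Import lra.

(** The space [Creal R] is topologized by the increasing seminorms
    [cnorm m f = sup_(|t| <= m) |f t|], and so are its closed subspaces, which are
    therefore Frechet spaces. In a complete space compact means closed and totally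
    bounded; hence a closed subspace [X] fails to be Montel if and only if it
    contains a sequence that is bounded for all the seminorms and whose terms are
    at mutual distance at least 1 for one of them ([not_montel_subspaceP]).

    Coanalytic ([montel_coanalytic]). The pairs of a sequence [g] of functions
    and a sequence of bounds, such that the terms of even index of [g] are such a
    bounded separated sequence, form a Polish space: the conditions are closed. A
    pair is mapped to the closed span of [g]. The closed span hits an open set if
    and only if one of countably many rational combinations of the [g n] belongs
    to it, so this map is Borel, and its range is the complement of [Mon R] since
    every closed subspace is separable.

    Hard ([montel_hard]). An analytic subset of a Polish space [Z] is a Suslin set:
    it consists of the [z] such that a tree [T z] of finite sequences of integers
    has an infinite branch, where each condition [T z s] is closed in [z]
    ([analytic_suslin]). To a finite sequence [s] corresponds a function [bump s],
    namely a tent of the sine supported near [peak s], with disjoint supports for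
    distinct [s], multiplied by a weight [growth s] whose increase up
    to [k] is governed by the codes of the initial segments of [s] of length less
    than [k]. The closed span of the [bump s] with [T z s] is a copy of a Koethe
    sequence space. Along an infinite branch the functions [bump s] are bounded
    and separated ([branch_not_montel]). Conversely a bounded separated sequence
    in the span must charge infinitely many [s]; the bounds at the level [k] control
    their initial segments of length less than [k], so that these are finitely many
    for each [k], and Koenig's lemma gives an infinite branch
    ([not_montel_branch]). Hence the span is Montel if and only if [T z] has no
    infinite branch, and it depends on [z] in a Borel way.

    Not analytic ([hard_not_analytic]). The preimage of an analytic set of
    subspaces under a Borel map is Suslin ([analytic_preimage_suslin]). If [Mon R]
    were analytic, then by hardness every coanalytic subset of the Baire space
    would be Suslin, which a diagonal argument refutes ([diagonalC_not_suslin]). *)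

Set Implicit Arguments.
Unset Strict Implicit.
Unset Printing Implicit Defensive.

Import Order.TTheory GRing.Theory Num.Theory.
Import numFieldNormedType.Exports.

Local Open Scope classical_set_scope.
Local Open Scope ring_scope.

(** * Topologies given by a sequence of pseudometrics *)

Section PseudometricSystem.
Context {R : realType} {T : Type}.
Variable rho : nat -> T -> T -> R.

Record pseudometrics : Prop := Pseudometrics {
  psm_refl : forall n x, rho n x x = 0 ;
  psm_sym : forall n x y, rho n x y = rho n y x ;
  psm_trian : forall n x y z, rho n x z <= rho n x y + rho n y z }.

Definition psm_separating := forall x y, (forall n, rho n x y = 0) -> x = y.

(** Using [m] both for the number of pseudometrics that are controlled and for
    the radius gives a basis of neighborhoods indexed by [nat]. *)
Definition pball (m : nat) (x : T) : set T :=
  [set y | forall n, (n <= m)%N -> rho n x y < m.+1%:R^-1].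

Definition psm_complete := forall u : nat -> T,
  (forall m, exists N, forall i j, (N <= i)%N -> (N <= j)%N ->
    pball m (u i) (u j)) ->
  exists l, forall m, exists N, forall i, (N <= i)%N -> pball m l (u i).

(** A form of separability that passes to subsets: for each [m], the space is a
    countable union of pieces (the fibres of [phi]) of diameter less than
    [m.+1%:R^-1]. *)
Definition psm_small := forall m, exists phi : T -> nat,
  forall x y, phi x = phi y -> pball m x y.

Definition psm_metric (x y : T) : R :=
  sup (range (fun n => Num.min (n.+1%:R^-1) (rho n x y))).

Lemma inv_natS_le m n : (m <= n)%N -> n.+1%:R^-1 <= m.+1%:R^-1 :> R.
Proof. by move=> mn; rewrite lef_pV2 ?posrE ?ltr0n// ler_nat. Qed.

Lemma exists_inv_natS_lt (e : R) : 0 < e -> exists m, m.+1%:R^-1 < e.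
Proof.
move=> e0; exists (Num.truncn e^-1).
rewrite -[ltRHS]invrK ltf_pV2 ?posrE ?ltr0n ?invr_gt0//.
by rewrite truncnS_gt.
Qed.

Lemma pball_le m n x : (m <= n)%N -> pball n x `<=` pball m x.
Proof.
move=> mn y xy k km; apply: lt_le_trans (inv_natS_le mn).
by apply: xy; exact: leq_trans mn.
Qed.

Lemma psm_metric_le x y e :
  (forall n, Num.min (n.+1%:R^-1) (rho n x y) <= e) -> psm_metric x y <= e.
Proof.
move=> H; apply: ge_sup; first by exists (Num.min (1%:R^-1) (rho 0 x y)), 0%N.
by move=> _ [n _ <-]; exact: H.
Qed.

Lemma le_psm_metric x y n : Num.min (n.+1%:R^-1) (rho n x y) <= psm_metric x y.
Proof.
apply: ub_le_sup; last by exists n.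
exists 1 => _ [k _ <-]; rewrite ge_min; apply/orP; left.
by rewrite invf_le1 ?ltr0n// ler1n.
Qed.

Lemma psm_metric_lt_pball m x y :
  psm_metric x y < m.+1%:R^-1 -> pball m x y.
Proof.
move=> xy n nm; have := le_lt_trans (le_psm_metric x y n) xy.
by rewrite gt_min => /orP[|//]; rewrite ltNge inv_natS_le.
Qed.

Lemma pball_psm_metric_le m x y :
  pball m x y -> psm_metric x y <= m.+1%:R^-1.
Proof.
move=> xy; apply: psm_metric_le => n; rewrite ge_min.
have [nm|mn] := leqP n m; first by rewrite (ltW (xy n nm)) orbT.
by rewrite inv_natS_le// ltnW.
Qed.

Hypothesis rhoP : pseudometrics.

Lemma psm_ge0 n x y : 0 <= rho n x y.
Proof.
have := psm_trian rhoP n x y x; rewrite (psm_refl rhoP) (psm_sym rhoP n y x).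
by rewrite -mulr2n pmulrn_lge0.
Qed.

Lemma pball_center m x : pball m x x.
Proof. by move=> n _; rewrite (psm_refl rhoP) invr_gt0 ltr0n. Qed.

Lemma pball_sym m x y : pball m x y -> pball m y x.
Proof. by move=> xy n nm; rewrite (psm_sym rhoP); exact: xy. Qed.

Lemma pball_trans m x y z :
  pball m.*2.+1 x y -> pball m.*2.+1 y z -> pball m x z.
Proof.
move=> xy yz n nm; apply: le_lt_trans (psm_trian rhoP n x y z) _.
have nm2 : (n <= m.*2.+1)%N.
  by apply: leq_trans nm _; rewrite -addnn -addnS leq_addr.
rewrite [ltRHS]splitr -!invfM -natrM muln2 doubleS.
by apply: ltrD; [exact: xy|exact: yz].
Qed.

(** Every smaller ball around a point of a ball eventually fits inside: balls
    are open, because only finitely many strict inequalities are involved. *)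
Lemma pball_interior m x y : pball m x y ->
  exists k, pball k y `<=` pball m x.
Proof.
move=> xy.
have [k Hk] : exists k, forall n, (n <= m)%N ->
    k.+1%:R^-1 <= m.+1%:R^-1 - rho n x y.
  have : forall j, exists k, forall n, (n < j)%N -> (n <= m)%N ->
      k.+1%:R^-1 <= m.+1%:R^-1 - rho n x y.
    elim=> [|j [k IH]]; first by exists 0%N.
    have [jm|jm] := leqP j m; last first.
      exists k => n; rewrite ltnS leq_eqVlt => /orP[/eqP ->|]; last exact: IH.
      by rewrite leqNgt jm.
    have /exists_inv_natS_lt[l ll] : 0 < m.+1%:R^-1 - rho j x y.
      by rewrite subr_gt0; exact: xy.
    exists (maxn k l) => n; rewrite ltnS leq_eqVlt => /orP[/eqP -> _|nj nm].
      by apply: le_trans (ltW ll); rewrite inv_natS_le// leq_maxr.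
    by apply: le_trans (IH n nj nm); rewrite inv_natS_le// leq_maxl.
  by move=> /(_ m.+1)[k Hk]; exists k => n nm; exact: Hk.
exists (maxn k m) => z yz n nm.
apply: le_lt_trans (psm_trian rhoP n x y z) _.
rewrite -ltrBrDl; apply: lt_le_trans (Hk n nm).
apply: lt_le_trans (inv_natS_le (leq_maxl k m)).
by apply: yz; apply: leq_trans nm _; exact: leq_maxr.
Qed.

End PseudometricSystem.

Section PseudometrizedTopology.
Context {R : realType} {T : topologicalType}.
Variable rho : nat -> T -> T -> R.

Definition psm_generates :=
  forall (x : T) (A : set T), nbhs x A <-> exists m, pball rho m x `<=` A.

Hypotheses (rhoP : pseudometrics rho) (rhoT : psm_generates).

Lemma pball_nbhs m x : nbhs x (pball rho m x).
Proof. by apply/rhoT; exists m. Qed.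

Lemma pball_open m x : open (pball rho m x).
Proof. by rewrite openE => y xy; apply/rhoT; exact: pball_interior. Qed.

Lemma psm_cvg (u : nat -> T) l :
  (forall m, exists N, forall i, (N <= i)%N -> pball rho m l (u i)) ->
  u @ \oo --> l.
Proof.
by move=> H A /rhoT[m mA]; have [N HN] := H m; exists N => // i Ni; exact/mA/HN.
Qed.

Lemma psm_metricP : psm_separating rho -> is_metric (psm_metric rho).
Proof.
move=> rhos; have min0 n : Num.min n.+1%:R^-1 0 = 0 :> R.
  by apply/min_idPr; rewrite invr_ge0 ler0n.
split=> [x|x y xy|x y|x y z].
- apply/eqP; rewrite eq_le; apply/andP; split.
    by apply: psm_metric_le => n; rewrite (psm_refl rhoP) min0.
  by rewrite -(min0 0%N) -(psm_refl rhoP 0 x) le_psm_metric.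
- apply: rhos => n; apply/eqP; rewrite eq_le psm_ge0// andbT leNgt.
  apply/negP => n0; have := le_psm_metric rho x y n; rewrite xy leNgt => /negP; apply.
  by rewrite lt_min n0 invr_gt0 ltr0n.
- by congr sup; apply: eq_imagel => n _; rewrite (psm_sym rhoP).
- apply: psm_metric_le => n.
  apply: le_trans (lerD (le_psm_metric rho x y n) (le_psm_metric rho y z n)).
  have a0 : 0 <= n.+1%:R^-1 :> R by rewrite invr_ge0 ler0n.
  have := psm_trian rhoP n x y z.
  move: (psm_ge0 rhoP n x y) (psm_ge0 rhoP n y z) (psm_ge0 rhoP n x z) a0.
  move: (n.+1%:R^-1) (rho n x z) (rho n x y) (rho n y z) => a p q r q0 r0 p0 a0 H.
  by rewrite ge_min; rewrite /Num.min; do 2 case: ifP; lra.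
Qed.

Lemma psm_metrizes : psm_separating rho -> metrizes (psm_metric rho).
Proof.
move=> rhos; split; first exact: psm_metricP.
move=> x A; split=> [/rhoT[m mA]|[e /exists_inv_natS_lt[m me] eA]].
  exists m.+1%:R^-1; first by rewrite invr_gt0 ltr0n.
  by move=> y /= xy; apply: mA; exact: psm_metric_lt_pball.
apply/rhoT; exists m => y xy; apply: eA => /=.
by apply: le_lt_trans me; exact: pball_psm_metric_le.
Qed.

Lemma psm_metric_complete :
  psm_complete rho -> complete_metric (psm_metric rho).
Proof.
move=> rhoc u cu; have [m|l Hl] := rhoc u; last by exists l; exact: psm_cvg.
have [|N HN] := cu m.+1%:R^-1; first by rewrite invr_gt0 ltr0n.
by exists N => i j Ni Nj; apply: psm_metric_lt_pball; exact: HN.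
Qed.

(** The basic open sets are indexed by the pieces that [psm_small] provides; the
    one that belongs to a piece is the interior of the union of the small balls
    around all the points of this piece. *)
Lemma psm_countable_base : psm_small rho ->
  exists U : nat -> set T, (forall i, open (U i)) /\
    forall x A, nbhs x A -> exists i, U i x /\ U i `<=` A.
Proof.
move=> /(_ _)/cid-/all_sig[phi phiP].
pose V (mc : nat * nat) : set T :=
  interior [set y | exists2 x, phi mc.1 x = mc.2 & pball rho mc.1 x y].
pose U i := if unpickle i is Some mc then V mc else set0.
exists U; split=> [i|x A /rhoT[m mA]].
  rewrite /U; case: unpickle => [mc|]; last exact: open0.
  exact: open_interior.
pose k := m.*2.+1; exists (pickle (k, phi k x)); rewrite /U pickleK; split.
  apply/rhoT; exists k => y xy /=; by exists x.
move=> y /interior_subset[/= x' xx' x'y]; apply: mA.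
apply: (pball_trans rhoP) x'y; exact: phiP.
Qed.

End PseudometrizedTopology.

Lemma countable_base_separable (T : topologicalType) (U : nat -> set T) :
  (forall x A, nbhs x A -> exists i, U i x /\ U i `<=` A) -> separable T.
Proof.
move=> baseU; have [[x0 _]|noT] := pselect (exists x : T, True); last first.
  by exists set0 => // O [x _] _; case: noT; exists x.
exists (range (fun i => xget x0 (U i))) => [|O [x Ox] oO].
  exact: card_image_le.
have [i [Uix UiO]] := baseU x O (open_nbhs_nbhs (conj oO Ox)).
exists (xget x0 (U i)); split; last by exists i.
by apply: UiO; exact: (xgetPex x0 (ex_intro _ x Uix)).
Qed.

Lemma psm_polish (R : realType) (T : topologicalType) (rho : nat -> T -> T -> R) :
  pseudometrics rho -> psm_generates rho -> psm_separating rho ->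
  psm_complete rho -> psm_small rho -> polish R T.
Proof.
move=> rhoP rhoT rhos rhoc /(psm_countable_base rhoP rhoT)[U [_ baseU]].
split; first exact: countable_base_separable baseU.
by exists (psm_metric rho); split;
  [exact: psm_metrizes|exact: psm_metric_complete].
Qed.

(** For carriers that have no topology of their own: the type [psm_type S] below
    is given the topology that the pseudometrics generate. *)
Record psmSpace (R : realType) := PsmSpace {
  psm_carrier :> Type ;
  psm_dist : nat -> psm_carrier -> psm_carrier -> R ;
  psm_distP : pseudometrics psm_dist }.

Section PsmTopology.
Context {R : realType} (S : psmSpace R).

Definition psm_type : Type := S.

Definition psm_nbhs (x : psm_type) : set_system psm_type :=
  [set A | exists m, pball (@psm_dist R S) m x `<=` A].

HB.instance Definition _ := gen_eqMixin psm_type.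
HB.instance Definition _ := gen_choiceMixin psm_type.
HB.instance Definition _ := hasNbhs.Build psm_type psm_nbhs.

Lemma psm_nbhs_filter (x : psm_type) : ProperFilter (nbhs x).
Proof.
split; first by move=> [m /(_ x)]; apply; exact/pball_center/psm_distP.
split=> [|A B [m mA] [n nB]|A B AB [m mA]].
- by exists 0%N.
- exists (maxn m n) => y xy; split.
    by apply: mA; exact: pball_le (leq_maxl m n) _ xy.
  by apply: nB; exact: pball_le (leq_maxr m n) _ xy.
- by exists m => y /mA/AB.
Qed.

Lemma psm_nbhs_singleton (x : psm_type) (A : set psm_type) : nbhs x A -> A x.
Proof. by move=> [m]; apply; exact/pball_center/psm_distP. Qed.

Lemma psm_nbhs_nbhs (x : psm_type) (A : set psm_type) :
  nbhs x A -> nbhs x (nbhs^~ A).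
Proof.
move=> [m mA]; exists m => y /(pball_interior (psm_distP S))[k kA].
by exists k; exact: subset_trans mA.
Qed.

HB.instance Definition _ := Nbhs_isNbhsTopological.Build psm_type
  psm_nbhs_filter psm_nbhs_singleton psm_nbhs_nbhs.

Lemma psm_type_generates :
  psm_generates (@psm_dist R S : nat -> psm_type -> psm_type -> R).
Proof. by []. Qed.

End PsmTopology.

Section TotallyBounded.
Context {R : realType} {T : topologicalType}.
Variable rho : nat -> T -> T -> R.
Hypotheses (rhoP : pseudometrics rho) (rhoT : psm_generates rho).

Definition psm_totally_bounded (K : set T) := forall m, exists s : seq T,
  forall x, K x -> exists2 y, y \in s & pball rho m y x.

Lemma ultrafilter_cover (F : set_system T) (s : seq T) (B : T -> set T) :
  UltraFilter F -> F [set x | exists2 y, y \in s & B y x] ->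
  exists y, F (B y).
Proof.
move=> FU; elim: s => [F0|y s IH Fys].
  have [x []//] : [set x : T | exists2 y, y \in [::] & B y x] !=set0.
  exact: filter_ex F0.
have [|FnB] := in_ultra_setVsetC (B y) FU; first by exists y.
apply: IH; apply: filterS2 Fys FnB => x [z + Bzx] nB.
by rewrite inE => /orP[/eqP zy|zs]; [rewrite zy in Bzx|exists z].
Qed.

(** An ultrafilter on a totally bounded set contains balls of arbitrarily small
    radius; points chosen in the intersections of these balls form a Cauchy
    sequence, to whose limit the ultrafilter converges. *)
Lemma totally_bounded_compact (K : set T) :
  psm_complete rho -> closed K -> psm_totally_bounded K -> compact K.
Proof.
move=> rhoc clK tbK; rewrite compact_ultra => F FU FK.
have /choice[c cF] : forall m, exists y, F (pball rho m y).
  move=> m; have [s sK] := tbK m; apply: (@ultrafilter_cover _ s) => //.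
  by apply: filterS FK; exact: sK.
have /choice[u uF] : forall m, exists x, K x /\
    forall k, (k <= m)%N -> pball rho k (c k) x.
  move=> m.
  suff /filter_ex : F (K `&` [set x | forall k, (k <= m)%N -> pball rho k (c k) x]).
    by [].
  apply: filterI => //.
  suff : forall j, F [set x | forall k, (k < j)%N -> pball rho k (c k) x].
    by move=> /(_ m.+1).
  elim=> [|j IH]; first by apply: filterS FK => x _ k.
  apply: filterS2 IH (cF j) => x xk xj k.
  by rewrite ltnS leq_eqVlt => /orP[/eqP ->|/xk].
have [m|l Hl] := rhoc u.
  exists m.*2.+1 => i j mi mj; apply: (pball_trans rhoP (y := c m.*2.+1)).
    by apply: (pball_sym rhoP); exact: (uF i).2.
  exact: (uF j).2.
exists l; split.
  apply: (closed_cvg _ clK _ _ (psm_cvg rhoT Hl)).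
  by apply: nearW => i; exact: (uF i).1.
move=> A /rhoT[m mA].
pose k := m.*2.+1; pose k' := k.*2.+1; have [N HN] := Hl k.
apply: filterS (cF k') => x xk; apply: mA.
have Ni := leq_maxl N k'; have ki := leq_maxr N k'.
apply: (pball_trans rhoP (HN _ Ni)).
apply: (pball_trans rhoP (y := c k')) => //.
by apply: (pball_sym rhoP); exact: (uF _).2.
Qed.

(** The terms are chosen one by one, each of them outside of the balls around the
    previous ones. *)
Lemma not_totally_bounded_seq (K : set T) : ~ psm_totally_bounded K ->
  exists m, exists2 f : nat -> T, (forall i, K (f i)) &
    forall i j, (i < j)%N -> ~ pball rho m (f i) (f j).
Proof.
move=> /existsNP[m ntb]; exists m.
have /choice[F HF] : forall s : seq T, exists x, K x /\
    forall y, y \in s -> ~ pball rho m y x.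
  move=> s; apply: contrapT => /forallNP nx; apply: ntb; exists s => x Kx.
  apply: contrapT => ny; apply: (nx x); split => // y ys yx.
  by apply: ny; exists y.
pose S n := iter n (fun s => F s :: s) [::].
exists (fun n => F (S n)) => [i|i j ij]; first exact: (HF _).1.
apply: (HF _).2; elim: j ij => // j IH; rewrite ltnS leq_eqVlt /S iterS inE.
by move=> /orP[/eqP ->|/IH ->]; rewrite ?eqxx ?orbT.
Qed.

End TotallyBounded.

(** * Frechet and Montel spaces given by an increasing sequence of seminorms *)

Section Seminorms.
Context {R : realType} {E : topologicalLmodType R}.
Variable p : nat -> E -> R.

Definition seminorm_dist n (x y : E) : R := p n (x - y).

Record increasing_seminorms : Prop := IncreasingSeminorms {
  seminormD : forall n x y, p n (x + y) <= p n x + p n y ;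
  seminormZ : forall n a x, p n (a *: x) = `|a| * p n x ;
  seminorm_le : forall m n x, (m <= n)%N -> p m x <= p n x }.

Local Notation rho := seminorm_dist.

Hypothesis pP : increasing_seminorms.

Lemma seminorm0 n : p n 0 = 0.
Proof. by rewrite -[0](scale0r (0 : E)) (seminormZ pP) normr0 mul0r. Qed.

Lemma seminormN n x : p n (- x) = p n x.
Proof. by rewrite -scaleN1r (seminormZ pP) normrN1 mul1r. Qed.

Lemma seminorm_distP : pseudometrics rho.
Proof.
split=> [n x|n x y|n x y z]; rewrite /rho.
- by rewrite subrr seminorm0.
- by rewrite -opprB seminormN.
- by rewrite -[x - z](subrKA y) (seminormD pP).
Qed.

Lemma seminorm_ge0 n x : 0 <= p n x.
Proof. by have := psm_ge0 seminorm_distP n x 0; rewrite /rho subr0. Qed.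

Lemma seminorm_pballE m x y : pball rho m x y <-> p m (x - y) < m.+1%:R^-1.
Proof.
split=> [|xy n nm]; first exact.
by apply: le_lt_trans xy; exact: seminorm_le.
Qed.

Hypotheses (pT : psm_generates rho) (psep : psm_separating rho)
  (pcomplete : psm_complete rho).

Lemma pball_convex m (x : E) : convex_set (pball rho m x : set (convex_lmodType E)).
Proof.
move=> y z l /set_mem/seminorm_pballE xy /set_mem/seminorm_pballE xz.
apply/mem_set/seminorm_pballE.
have -> : x - (conv l y z : convex_lmodType E) =
    l%:num *: (x - y) + (1 - l%:num) *: (x - z).
  have -> : (conv l y z : convex_lmodType E) =
    l%:num *: (y : E) + (1 - l%:num) *: (z : E) by [].
  rewrite !scalerBr addrACA -opprD -scalerDl.
  by rewrite (_ : l%:num + (1 - l%:num) = 1) ?scale1r// addrC subrK.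
apply: le_lt_trans (seminormD pP _ _ _) _; rewrite !(seminormZ pP).
have l0 : 0 <= l%:num by []. 
have l1 : l%:num <= 1 by [].
rewrite !ger0_norm ?subr_ge0//.
have [l00|l00] := eqVneq l%:num 0.
  by rewrite l00 mul0r add0r subr0 mul1r.
have {l0 l00}l0 : 0 < l%:num by rewrite lt_def l00.
rewrite [ltRHS](_ : _ = l%:num * m.+1%:R^-1 + (1 - l%:num) * m.+1%:R^-1).
  apply: ltr_leD; first by rewrite ltr_pM2l.
  by apply: ler_wpM2l; [rewrite subr_ge0|exact: ltW].
by rewrite -mulrDl addrC subrK mul1r.
Qed.

Lemma seminorm_frechet : frechet_space E.
Proof.
split.
- exists [set B | exists m x, B = pball rho m x].
    by move=> _ /set_mem[m [x ->]]; exact: pball_convex.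
  split=> [_ [m [x ->]]|x A /pT[m mA]].
    exact: (pball_open seminorm_distP pT).
  exists (pball rho m x) => //; split; first by exists m, x.
  exact: (pball_center seminorm_distP).
- exists (psm_metric rho); split; last exact: psm_metric_complete.
  exact: (psm_metrizes seminorm_distP).
- exists (psm_metric rho); split; first exact: (psm_metrizes seminorm_distP).
  move=> x y z; rewrite /psm_metric; congr sup; apply: eq_imagel => n _.
  by rewrite /rho opprD addrACA subrr addr0.
Qed.

Lemma bounded_subsetP (K : set E) : bounded_subset K <->
  forall n, exists M, forall x, K x -> p n x <= M.
Proof.
split=> [bK n|bK U /pT[m mU]].
  have [|a aK] := bK (pball rho n 0); first exact: (pball_nbhs pT).
  exists `|a| => _ /aK[y + <-]; rewrite seminorm_pballE sub0r seminormN => yn.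
  rewrite (seminormZ pP) ler_piMr//; apply: le_trans (ltW yn) _.
  by rewrite invf_le1 ?ltr0n// ler1n.
have [M HM] := bK m; pose a := m.+1%:R * (`|M| + 1).
have a0 : 0 < a by rewrite mulr_gt0 ?ltr0n// ltr_wpDl.
exists a => x Kx; exists (a^-1 *: x); last by rewrite scalerA divff ?scale1r ?gt_eqF.
apply/mU/seminorm_pballE; rewrite sub0r seminormN (seminormZ pP).
rewrite gtr0_norm ?invr_gt0// /a invfM -mulrA -[ltRHS]mulr1.
rewrite ltr_pM2l ?invr_gt0 ?ltr0n// mulrC ltr_pdivrMr ?ltr_wpDl// mul1r.
by rewrite (le_lt_trans (HM x Kx))// (le_lt_trans (ler_norm M))// ltrDl.
Qed.

(** In a complete space, compact means closed and totally bounded. A single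
    sequence of natural numbers records both the bounds of the sequence [f] and
    the index of a seminorm for which its terms are far apart: increasing a bound
    or this index does no harm, so that [M 0] can serve both purposes. *)
Lemma not_montelP : ~ montel_space E <->
  exists (f : nat -> E) (M : nat -> nat),
    (forall n i, p n (f i) <= (M n)%:R) /\
    (forall i j, i <> j -> 1 <= p (M 0%N) (f i - f j)).
Proof.
split=> [nmE|[f [M [fM fsep]]] [_ mE]].
  have : ~ forall K : set E, closed K -> bounded_subset K -> compact K.
    by move=> H; apply: nmE; split => //; exact: seminorm_frechet.
  move=> /existsNP[K /not_implyP[clK /not_implyP[/bounded_subsetP/choice[b Kb] ncK]]].
  have : ~ psm_totally_bounded rho K.
    by move=> /(totally_bounded_compact seminorm_distP pT pcomplete clK).
  move=> /not_totally_bounded_seq[m [f Kf fsep]].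
  exists (fun i => m.+1%:R *: f i).
  exists (fun n => (Num.truncn (m.+1%:R * b n) + m).+1); split=> [n i|].
    rewrite (seminormZ pP) ger0_norm//.
    apply: (@le_trans _ _ (m.+1%:R * b n)); first by rewrite ler_wpM2l// Kb.
    apply: le_trans (ltW (truncnS_gt _)) _.
    by rewrite ler_nat ltnS leq_addr.
  have H i j : (i < j)%N ->
      1 <= p (Num.truncn (m.+1%:R * b 0) + m).+1 (m.+1%:R *: f i - m.+1%:R *: f j).
    move=> ij; rewrite -scalerBr (seminormZ pP) ger0_norm//.
    rewrite -ler_pdivrMl ?ltr0n// mulr1.
    apply: (@le_trans _ _ (p m (f i - f j))); last first.
      by apply: seminorm_le => //; rewrite leqW// leq_addl.
    by rewrite leNgt; apply/negP => /seminorm_pballE; exact: fsep.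
  move=> i j /eqP; rewrite neq_ltn => /orP[|ji]; first exact: H.
  by rewrite -opprB seminormN; exact: H.
pose K := [set x : E | forall n, p n x <= (M n)%:R].
have clK : closed K.
  move=> x clx n; rewrite leNgt; apply/negP; rewrite -subr_gt0.
  move=> /exists_inv_natS_lt[m mM].
  have [y [Ky xy]] := clx _ (pball_nbhs pT (maxn m n) x).
  have := xy n (leq_maxr m n); rewrite ltNge => /negP; apply; rewrite /rho.
  apply: (le_trans (inv_natS_le (leq_maxl m n))); apply: (le_trans (ltW mM)).
  rewrite lerBlDr; apply: le_trans (lerD (lexx _) (Ky n)).
  by rewrite -{1}[x](subrK y) (seminormD pP).
have bK : bounded_subset K by apply/bounded_subsetP => n; exists (M n)%:R => x.
have fK : (f @ \oo) K by exists 0%N => // i _ n; exact: fM.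
have [x [_ clx]] := mE K clK bK (f @ \oo) _ fK.
pose k := (maxn (M 0) 1).*2.+1.
have H N : exists2 i, (N <= i)%N & pball rho k x (f i).
  have [||y [[i Ni <-] xfi]] := clx (f @` [set i | (N <= i)%N]) (pball rho k x).
  - by exists N => // i Ni; exists i.
  - exact: (pball_nbhs pT).
  - by exists i.
have [i _ xi] := H 0%N; have [j ij xj] := H i.+1.
have := pball_trans seminorm_distP (pball_sym seminorm_distP xi) xj.
move=> /(_ _ (leq_maxl (M 0) 1)); apply/negP; rewrite -leNgt /rho.
apply: (@le_trans _ _ 1); first by rewrite invf_le1 ?ltr0n// ler1n.
by apply: fsep => eij; rewrite eij ltnn in ij.
Qed.

End Seminorms.

(** * The seminorms of the space of continuous functions *)

Section CrealNorm.
Context {R : realType}.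
Implicit Types f g : Creal R.

Definition cnorm (m : nat) f : R :=
  sup [set `|val f t| | t in [set t : R | `|t| <= m%:R]].

Lemma Creal_continuous f : continuous (val f : R -> R).
Proof. exact: (@cts_fun _ _ (f : continuousType R R)). Qed.

Lemma Creal_sub_scaleE a f g t :
  (val (f - g) t = val f t - val g t) * (val (a *: f) t = a * val f t).
Proof. by split; [rewrite -scaleN1r Creal_addE Creal_scaleE mulN1r|exact: Creal_scaleE]. Qed.

Lemma normed_ball_itv (m : nat) : [set t : R | `|t| <= m%:R] = `[- m%:R, m%:R]%classic.
Proof. by apply/seteqP; split => t /=; rewrite in_itv/= ler_norml. Qed.

Lemma normed_ball_compact (m : nat) : compact [set t : R | `|t| <= m%:R].
Proof. by rewrite normed_ball_itv; exact: segment_compact. Qed.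

Lemma cnorm_ge m f t : `|t| <= m%:R -> `|val f t| <= cnorm m f.
Proof.
move=> tm; apply: ub_le_sup; last by exists t.
have cf : {within [set t : R | `|t| <= m%:R], continuous (val f : R -> R)}.
  by apply: continuous_subspaceT; exact: Creal_continuous.
have [M [_ fM]] := compact_bounded (continuous_compact cf (@normed_ball_compact m)).
exists (`|M| + 1) => _ [s sm <-]; apply: fM; last by exists s.
by rewrite (le_lt_trans (ler_norm M))// ltrDl.
Qed.

Lemma cnorm_le m f e :
  (forall t, `|t| <= m%:R -> `|val f t| <= e) -> cnorm m f <= e.
Proof.
move=> H; apply: ge_sup => [|_ [t tm <-]]; last exact: H.
by exists `|val f 0|, 0 => //=; rewrite normr0.
Qed.

Lemma cnorm_seminorms : increasing_seminorms cnorm.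
Proof.
split=> [n f g|n a f|m n f mn].
- apply: cnorm_le => t tn; rewrite Creal_addE.
  by rewrite (le_trans (ler_normD _ _))// lerD// cnorm_ge.
- have H b h : cnorm n (b *: h) <= `|b| * cnorm n h.
    apply: cnorm_le => t tn; rewrite Creal_scaleE normrM.
    by rewrite ler_wpM2l// cnorm_ge.
  apply/eqP; rewrite eq_le H/=; have [->|a0] := eqVneq a 0.
    rewrite normr0 mul0r; apply: le_trans (@cnorm_ge n _ 0 _) => //.
    by rewrite normr0.
  rewrite -ler_pdivlMl ?normr_gt0// -normfV.
  by apply: le_trans (H _ _); rewrite scalerA mulVf// scale1r.
- apply: cnorm_le => t tm; apply: cnorm_ge; apply: le_trans tm _.
  by rewrite ler_nat.
Qed.

Lemma norm_le_nat (t : R) : exists n : nat, `|t| <= n%:R.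
Proof. by exists (Num.truncn `|t|).+1; rewrite ltW// truncnS_gt. Qed.

Lemma cnorm_separating : psm_separating (seminorm_dist cnorm).
Proof.
move=> f g fg; apply: val_inj; apply/funext => t.
have [n tn] := norm_le_nat t; apply/eqP; rewrite -subr_eq0 -normr_le0.
by rewrite -(Creal_sub_scaleE 0) -(fg n) cnorm_ge.
Qed.

Lemma cnorm_generates : psm_generates (seminorm_dist cnorm).
Proof.
move=> f A; split=> [fA|[m mA]].
  (* the balls form a filter that converges to [f] *)
  pose F : set_system (Creal R) :=
    [set B | exists m, pball (seminorm_dist cnorm) m f `<=` B].
  have FF : Filter F.
    split=> [|B C [m mB] [n nC]|B C BC [m mB]].
    - by exists 0%N.
    - exists (maxn m n) => g fg; split.
        by apply: mB; exact: pball_le (leq_maxl m n) _ fg.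
      by apply: nC; exact: pball_le (leq_maxr m n) _ fg.
    - by exists m => g /mB/BC.
  suff : id @ F --> f by apply.
  apply: Creal_cvg => K e cK /exists_inv_natS_lt[m me].
  have [n Kn] : exists n : nat, forall t, K t -> `|t| <= n%:R.
    have [M [_ KM]] := compact_bounded cK.
    have [n Mn] := norm_le_nat (`|M| + 1); exists n => t Kt.
    apply: le_trans Mn; rewrite [leRHS]ger0_norm; last by rewrite addr_ge0.
    by apply: KM => //; rewrite (le_lt_trans (ler_norm M))// ltrDl.
  exists (maxn m n) => g fg t Kt; rewrite -(Creal_sub_scaleE 0).
  apply: le_lt_trans (cnorm_ge _ (Kn _ Kt)) _; apply: lt_trans me.
  by apply: lt_le_trans (fg _ (leq_maxr m n)) (inv_natS_le (leq_maxl m n)).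
have /(Creal_near f (@normed_ball_compact m)) : 0 < m.+2%:R^-1 :> R.
  by rewrite invr_gt0 ltr0n.
apply: filterS => g fg; apply: mA; apply/(seminorm_pballE cnorm_seminorms).
apply: (@le_lt_trans _ _ m.+2%:R^-1).
  apply: cnorm_le => t tm; rewrite (Creal_sub_scaleE 0) ltW//; exact: fg.
by rewrite ltf_pV2 ?posrE ?ltr0n// ltr_nat.
Qed.

(** A uniform limit on all bounded intervals is continuous. *)
Lemma cnorm_complete : psm_complete (seminorm_dist cnorm).
Proof.
move=> u cu.
have cut m : exists N, forall i j (t : R), (N <= i)%N -> (N <= j)%N ->
    `|t| <= m%:R -> `|val (u i) t - val (u j) t| <= m.+1%:R^-1.
  have [N HN] := cu m; exists N => i j t Ni Nj tm.
  rewrite -(Creal_sub_scaleE 0); apply: ltW.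
  by apply: le_lt_trans (HN i j Ni Nj _ (leqnn m)); exact: cnorm_ge.
have cvgu (t : R) : cvg ((fun i => val (u i) t : R) @ \oo).
  apply/cauchy_cvgP/cauchy_exP => e e0.
  have [n tn] := norm_le_nat t; have [m me] := exists_inv_natS_lt e0.
  have [N HN] := cut (maxn m n); exists (val (u N) t); exists N => // j Nj /=.
  apply: (@le_lt_trans _ _ (maxn m n).+1%:R^-1); last first.
    by apply: le_lt_trans me; exact: inv_natS_le (leq_maxl m n).
  by apply: HN => //; apply: le_trans tn _; rewrite ler_nat leq_maxr.
pose l (t : R) : R := lim ((fun i => val (u i) t : R) @ \oo).
have ul m : exists N, forall i (t : R), (N <= i)%N ->
    `|t| <= m%:R -> `|l t - val (u i) t| <= m.+1%:R^-1.
  have [N HN] := cut m; exists N => i t Ni tm.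
  have cvgd : (fun j => `|val (u j) t - val (u i) t|) @ \oo --> `|l t - val (u i) t|.
    by apply: cvg_norm; apply: cvgB; [exact: cvgu|exact: cvg_cst].
  apply: (closed_cvg _ (@closed_le R m.+1%:R^-1) _ _ cvgd).
  by exists N => // j Nj /=; exact: HN.
have cl : continuous l.
  move=> t; apply/cvgrPdist_lt => e e0.
  have [m me] : exists m, m.+1%:R^-1 < e / 3.
    by apply: exists_inv_natS_lt; rewrite divr_gt0.
  have [n tn] := norm_le_nat (`|t| + 1); have [N HN] := ul (maxn m n).
  have H s : `|s| <= `|t| + 1 -> `|l s - val (u N) s| < e / 3.
    move=> st; apply: le_lt_trans me.
    apply: le_trans (inv_natS_le (leq_maxl m n)); apply: HN => //.
    apply: le_trans st _; apply: le_trans (ler_norm _) _; apply: le_trans tn _.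
    by rewrite ler_nat leq_maxr.
  have e30 : 0 < e / 3 by rewrite divr_gt0.
  have near1 := nbhsx_ballx t _ (ltr01 : 0 < 1 :> R).
  have near2 : \forall s \near t, `|val (u N) t - val (u N) s| < e / 3.
    by have /cvgrPdist_lt := @Creal_continuous (u N) t; apply.
  apply: filterS2 near1 near2 => s.
  rewrite /ball/= => ts uts.
  have st : `|s| <= `|t| + 1.
    rewrite -[s](subrK t) addrC (le_trans (ler_normD _ _))// lerD2l.
    by rewrite distrC ltW.
  have lt_ := H t; have ls := H s st; rewrite lerDl ler01 in lt_.
  have {}lt_ := lt_ isT.
  have -> : l t - l s = (l t - val (u N) t) + (val (u N) t - val (u N) s)
     - (l s - val (u N) s) by lra.
  apply: le_lt_trans (ler_normB _ _) _.
  have := ler_normD (l t - val (u N) t) (val (u N) t - val (u N) s).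
  by lra.
exists (Creal_Sub (mem_set cl : l \in @contp R)) => m.
have [N HN] := ul m.+1; exists N => i Ni.
apply/(seminorm_pballE cnorm_seminorms); apply: (@le_lt_trans _ _ m.+2%:R^-1).
  apply: cnorm_le => t tm; rewrite (Creal_sub_scaleE 0); apply: HN => //.
  by apply: le_trans tm _; rewrite ler_nat.
by rewrite ltf_pV2 ?posrE ?ltr0n// ltr_nat.
Qed.

Lemma Creal_uniform_continuous (m : nat) f e : 0 < e ->
  exists n, forall s t : R, `|s| <= m%:R -> `|s - t| <= n.+1%:R^-1 ->
    `|val f s - val f t| <= e.
Proof.
move=> e0.
suff [N _ /(_ N (leqnn N)) HN] : \forall n \near \oo, [set s : R | `|s| <= m%:R] `<=`
    [set s | forall t, `|s - t| <= n.+1%:R^-1 -> `|val f s - val f t| <= e].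
  by exists N => s t sm; exact: HN.
have /compact_near_coveringP := @normed_ball_compact m; apply => x _.
have e20 : 0 < e / 2 by rewrite divr_gt0.
have : \forall s \near x, `|val f x - val f s| < e / 2.
  by have /cvgrPdist_lt := @Creal_continuous f x; apply.
move=> /nbhs_ballP[d /= d0 dx].
have d20 : 0 < d / 2 by rewrite divr_gt0.
have [N Nd] := exists_inv_natS_lt d20.
exists (ball x (d / 2), [set n | (N <= n)%N]) => /=.
  by split; [exact: nbhsx_ballx|exists N].
move=> [s n] /= [xs Nn] t st.
have xs' : `|x - s| < d / 2 by exact: xs.
have fs : `|val f x - val f s| < e / 2.
  by apply: dx; rewrite /ball/= (lt_trans xs')// ltr_pdivrMr// ltr_pMr// ltr1n.
have ft : `|val f x - val f t| < e / 2.
  apply: dx; rewrite /ball/= -(subrKA s) (le_lt_trans (ler_normD _ _))//.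
  rewrite [ltRHS]splitr ltrD//; apply: le_lt_trans st _.
  exact: le_lt_trans (inv_natS_le Nn) Nd.
rewrite -(subrKA (val f x)) (le_trans (ler_normD _ _))// [leRHS]splitr lerD//.
  by rewrite distrC ltW.
exact: ltW.
Qed.

(** A continuous function is determined on a bounded interval, up to a given
    error, by a mesh that is fine enough for its modulus of continuity together
    with its rounded values on this mesh; these are finitely many integers. *)
Lemma cnorm_small : psm_small (seminorm_dist cnorm).
Proof.
move=> m; pose c : R := (4 * m.+1)%:R; have c0 : 0 < c by rewrite ltr0n.
have cV0 : 0 < c^-1 by rewrite invr_gt0.
have /(_ _)/cid-/all_sig[n nP] f := Creal_uniform_continuous m f cV0.
pose q (k l : nat) : R := l%:R / k.+1%:R - m%:R.
pose mesh k := (2 * m * k.+1).+1.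
pose v k f := [seq Num.floor (val f (q k l) * c) | l <- iota 0 (mesh k)].
exists (fun f => pickle (n f, v (n f) f)) => f g /(pcan_inj pickleK) fg.
have nfg : n f = n g := congr1 fst fg.
have vfg : v (n f) f = v (n g) g := congr1 snd fg.
rewrite -nfg in vfg; clear fg.
have fP := nP f; have gP := nP g; rewrite -nfg in gP; move: (n f) vfg fP gP.
move=> {nfg nP} k vfg fP gP.
apply/(seminorm_pballE cnorm_seminorms); apply: (@le_lt_trans _ _ (3 * c^-1)).
  apply: cnorm_le => t tm; rewrite (Creal_sub_scaleE 0).
  have k0 : 0 < k.+1%:R :> R by rewrite ltr0n.
  pose x : R := (t + m%:R) * k.+1%:R; pose l := Num.truncn x.
  have x0 : 0 <= x.
    rewrite mulr_ge0 ?ler0n// -lerBlDr sub0r.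
    by move: tm; rewrite ler_norml => /andP[].
  have lx : l%:R <= x < l.+1%:R by apply: truncn_itv.
  have tq : `|t - q k l| <= k.+1%:R^-1.
    rewrite (_ : t - q k l = (x - l%:R) / k.+1%:R); last first.
      by rewrite /q /x mulrBl mulfK ?gt_eqF// opprB addrA.
    rewrite normrM normfV (gtr0_norm k0) ler_piMl ?invr_ge0 ?ler0n//.
    move: lx => /andP[lx xl]; rewrite ger0_norm ?subr_ge0// lerBlDr.
    by rewrite addrC natr1 ltW.
  have ll : (l < mesh k)%N.
    rewrite ltnS -(ler_nat R); move: lx => /andP[lx _]; apply: le_trans lx _.
    rewrite natrM ler_wpM2r ?ler0n// natrM mulr_natl mulr2n lerD2r.
    exact: le_trans (ler_norm _) tm.
  have : Num.floor (val f (q k l) * c) = Num.floor (val g (q k l) * c).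
    move: vfg => /(congr1 (fun s => nth 0 s l)).
    by rewrite !(nth_map 0%N) ?size_iota// nth_iota.
  move=> fl; have fgq : `|val f (q k l) - val g (q k l)| <= c^-1.
    rewrite -(ler_pM2r c0) mulVf ?gt_eqF// -{1}(gtr0_norm c0) -normrM mulrBl.
    have /andP[f1 f2] := floor_itv (val f (q k l) * c).
    have /andP[g1 g2] := floor_itv (val g (q k l) * c).
    rewrite -fl in g1 g2; rewrite intrD in f2 g2.
    by rewrite ler_norml; apply/andP; split; lra.
  have := fP t _ tm tq; have := gP t _ tm tq; rewrite [`|val g t - _|]distrC.
  have -> : val f t - val g t = (val f t - val f (q k l)) +
    (val f (q k l) - val g (q k l)) + (val g (q k l) - val g t) by lra.
  move=> H1 H2; apply: le_trans (ler_normD _ _) _.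
  by rewrite mulr_natl mulrSr mulr2n lerD// (le_trans (ler_normD _ _))// lerD.
by rewrite ltr_pdivrMr// /c natrM mulrCA mulVf ?pnatr_eq0// mulr1 ltr_nat.
Qed.

End CrealNorm.

(** * Closed subspaces of the space of continuous functions *)

Section Subspace.
Context {R : realType}.
Variable X : closed_subspace (Creal R).

Definition subspace_norm n (x : subspace_type X) : R := cnorm n (val x).

Lemma subspace_seminorms : increasing_seminorms subspace_norm.
Proof.
split=> [n x y|n a x|m n x mn]; rewrite /subspace_norm.
- by rewrite (raddfD (val : subspace_type X -> _)) (seminormD cnorm_seminorms).
- by rewrite (linearZZ (val : subspace_type X -> _)) (seminormZ cnorm_seminorms).
- exact: (seminorm_le cnorm_seminorms).
Qed.

Lemma subspace_distE n (x y : subspace_type X) :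
  seminorm_dist subspace_norm n x y = seminorm_dist cnorm n (val x) (val y).
Proof. by rewrite /seminorm_dist /subspace_norm (raddfB (val : subspace_type X -> _)). Qed.

Lemma subspace_pballE m (x y : subspace_type X) :
  pball (seminorm_dist subspace_norm) m x y <->
  pball (seminorm_dist cnorm) m (val x) (val y).
Proof.
by split=> xy n nm; [rewrite -subspace_distE|rewrite subspace_distE]; exact: xy.
Qed.

Lemma subspace_generates : psm_generates (seminorm_dist subspace_norm).
Proof.
move=> x A; split=> [[_ [[B oB <-] Bx BA]]|[m mA]].
  have [m mB] := (cnorm_generates (val x) B).1 (open_nbhs_nbhs (conj oB Bx)).
  by exists m => y /subspace_pballE/mB By; exact: BA.
have xm : nbhs x (val @^-1` pball (seminorm_dist cnorm) m (val x)).
  exact: (@subspace_val_continuous R (Creal R) X x _ (pball_nbhs cnorm_generates m _)).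
by apply: filterS xm => y xy; apply: mA; exact/subspace_pballE.
Qed.

Lemma subspace_separating : psm_separating (seminorm_dist subspace_norm).
Proof.
move=> x y xy; apply: val_inj; apply: cnorm_separating => n.
by rewrite -subspace_distE.
Qed.

Lemma subspace_complete : psm_complete (seminorm_dist subspace_norm).
Proof.
move=> u cu; have [m|l Hl] := cnorm_complete (u := fun i => val (u i)).
  have [N HN] := cu m; exists N => i j Ni Nj.
  by apply: (subspace_pballE m (u i) (u j)).1; exact: HN.
have Xl : (X : set (Creal R)) l.
  apply: (closed_cvg _ (@subspace_closed R _ X) _ _ (psm_cvg cnorm_generates Hl)).
  by apply: nearW => i; have /set_mem := valP (u i).
exists (Sub l (mem_set Xl)) => m; have [N HN] := Hl m; exists N => i Ni.
by apply/subspace_pballE; exact: HN.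
Qed.

Lemma not_montel_subspaceP : ~ montel_space (subspace_type X) <->
  exists (f : nat -> Creal R) (M : nat -> nat), [/\ forall i, (X : set _) (f i),
    forall n i, cnorm n (f i) <= (M n)%:R &
    forall i j, i <> j -> 1 <= cnorm (M 0%N) (f i - f j)].
Proof.
have H := not_montelP subspace_seminorms subspace_generates subspace_separating
  subspace_complete.
split=> [/H[f [M [fM fsep]]]|[f [M [Xf fM fsep]]]].
  exists (fun i => val (f i)), M; split=> [i|n i|i j ij].
  - by have /set_mem := valP (f i).
  - exact: fM.
  - by rewrite -(raddfB (val : subspace_type X -> _)); exact: fsep.
apply/H; pose g i : subspace_type X := Sub (f i) (mem_set (Xf i)).
exists g, M; split=> [n i|i j ij]; first exact: fM.
by rewrite /subspace_norm (raddfB (val : subspace_type X -> _)); exact: fsep.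
Qed.

End Subspace.

(** * Constructions of Polish spaces *)

Definition polish_psm (R : realType) (T : Type) (rho : nat -> T -> T -> R) :=
  [/\ pseudometrics rho, psm_separating rho, psm_complete rho & psm_small rho].

Lemma polish_psm_type (R : realType) (S : psmSpace R) :
  polish_psm (@psm_dist R S) -> polish R (psm_type S).
Proof. by move=> [SP Ss Sc Sm]; exact: (@psm_polish R (psm_type S) (@psm_dist R S)). Qed.

Lemma psm_continuous (R : realType) (T T' : topologicalType)
    (rho : nat -> T -> T -> R) (rho' : nat -> T' -> T' -> R) (f : T -> T') :
  psm_generates rho -> psm_generates rho' ->
  (forall m, exists k, forall x y, pball rho k x y -> pball rho' m (f x) (f y)) ->
  continuous f.
Proof.
move=> rhoT rhoT' H x A /rhoT'[m mA]; apply/rhoT.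
by have [k Hk] := H m; exists k => y /Hk/mA.
Qed.

Section Discrete.
Context {R : realType} (C : countType).

Definition discrete_dist (n : nat) (x y : C) : R := (x != y)%:R.

Lemma discrete_pballE m x y : pball discrete_dist m x y <-> x = y.
Proof.
split=> [/(_ 0%N (leq0n m))|-> n nm].
  rewrite /discrete_dist; have [//|_] := eqVneq x y.
  by rewrite ltNge invf_le1 ?ltr0n// ler1n.
by rewrite /discrete_dist eqxx invr_gt0 ltr0n.
Qed.

Lemma discrete_polish : polish_psm discrete_dist.
Proof.
split.
- split=> [n x|n x y|n x y z]; rewrite /discrete_dist ?eqxx// 1?eq_sym//.
  have [->|xz] := eqVneq x z; first by rewrite addr_ge0 ?ler0n.
  have [xy|xy] := eqVneq x y; last by rewrite lerDl ler0n.
  by rewrite xy in xz; rewrite xz add0r.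
- move=> x y xy; apply/(@discrete_pballE 0) => n _.
  by rewrite xy invr_gt0 ltr0n.
- move=> u cu; have [N HN] := cu 0%N; exists (u N) => m; exists N => i Ni.
  by apply/discrete_pballE/(@discrete_pballE 0)/HN.
- by move=> m; exists pickle => x y /(pcan_inj pickleK) ->; exact/discrete_pballE.
Qed.

End Discrete.
Arguments discrete_dist R C : clear implicits.

Section Product.
Context {R : realType} {T1 T2 : Type}.
Variables (rho1 : nat -> T1 -> T1 -> R) (rho2 : nat -> T2 -> T2 -> R).

Definition prod_dist n (x y : T1 * T2) : R :=
  Num.max (rho1 n x.1 y.1) (rho2 n x.2 y.2).

Lemma prod_pballE m x y : pball prod_dist m x y <->
  pball rho1 m x.1 y.1 /\ pball rho2 m x.2 y.2.
Proof.
split=> [xy|[xy1 xy2] n nm]; last by rewrite gt_max xy1// xy2.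
by split=> n nm; have := xy n nm; rewrite gt_max => /andP[].
Qed.

Lemma prod_polish : polish_psm rho1 -> polish_psm rho2 -> polish_psm prod_dist.
Proof.
move=> [P1 s1 c1 m1] [P2 s2 c2 m2]; split.
- split=> [n x|n x y|n x y z]; rewrite /prod_dist.
  + by rewrite !psm_refl// maxxx.
  + by rewrite (psm_sym P1) (psm_sym P2).
  + rewrite ge_max (le_trans (psm_trian P1 n _ y.1 _)).
      by rewrite (le_trans (psm_trian P2 n _ y.2 _))// lerD// le_max lexx orbT.
    by rewrite lerD// le_max lexx.
- move=> [x1 x2] [y1 y2] xy; congr pair; [apply: s1|apply: s2] => n;
    apply/eqP; rewrite eq_le psm_ge0// andbT -(xy n) /prod_dist le_max lexx//.
  by rewrite orbT.
- move=> u cu.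
  have [m|l1 Hl1] := c1 (fst \o u).
    by have [N HN] := cu m; exists N => i j Ni Nj; have /prod_pballE[] := HN i j Ni Nj.
  have [m|l2 Hl2] := c2 (snd \o u).
    by have [N HN] := cu m; exists N => i j Ni Nj; have /prod_pballE[] := HN i j Ni Nj.
  exists (l1, l2) => m; have [N1 HN1] := Hl1 m; have [N2 HN2] := Hl2 m.
  exists (maxn N1 N2) => i; rewrite geq_max => /andP[N1i N2i].
  by apply/prod_pballE; split; [exact: HN1|exact: HN2].
- move=> m; have [phi1 H1] := m1 m; have [phi2 H2] := m2 m.
  exists (fun x => pickle (phi1 x.1, phi2 x.2)) => x y /(pcan_inj pickleK) xy.
  by apply/prod_pballE; split; [apply: H1 (congr1 fst xy)|apply: H2 (congr1 snd xy)].
Qed.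

End Product.

Section Power.
Context {R : realType} {T : Type}.
Variable rho : nat -> T -> T -> R.

(** The product of countably many copies of [T]; [n] codes a coordinate and a
    pseudometric of this coordinate. *)
Definition power_dist (n : nat) (x y : nat -> T) : R :=
  let ij := odflt (0, 0)%N (unpickle n) in rho ij.2 (x ij.1) (y ij.1).

Lemma pball_power_coord m i : exists k, forall x y,
  pball power_dist k x y -> pball rho m (x i) (y i).
Proof.
exists (maxn m (\max_(j < m.+1) pickle (i, nat_of_ord j))) => x y xy j jm.
have jk : (pickle (i, j) <= maxn m (\max_(j < m.+1) pickle (i, nat_of_ord j)))%N.
  rewrite leq_max; apply/orP; right.
  by have := @leq_bigmax _ (fun j : 'I_m.+1 => pickle (i, nat_of_ord j))
    (Ordinal (jm : (j < m.+1)%N)).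
have := xy _ jk; rewrite /power_dist pickleK/= => /lt_le_trans; apply.
exact/inv_natS_le/leq_maxl.
Qed.

Lemma pball_power m : exists k, forall x y,
  (forall i, (i <= k)%N -> pball rho k (x i) (y i)) -> pball power_dist m x y.
Proof.
pose c n := odflt (0, 0)%N (unpickle n) : nat * nat.
exists (maxn m (\max_(n < m.+1) maxn (c n).1 (c n).2)) => x y xy n nm.
have : (maxn (c n).1 (c n).2 <= maxn m (\max_(n < m.+1) maxn (c n).1 (c n).2))%N.
  rewrite leq_max; apply/orP; right.
  exact: (@leq_bigmax _ (fun n : 'I_m.+1 => maxn (c n).1 (c n).2)
    (Ordinal (nm : (n < m.+1)%N))).
rewrite geq_max => /andP[/xy H /H]; move/lt_le_trans; apply.
exact/inv_natS_le/leq_maxl.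
Qed.

Lemma eventually_all (P : nat -> nat -> Prop) k :
  (forall i, exists N, forall n, (N <= n)%N -> P i n) ->
  exists N, forall n, (N <= n)%N -> forall i, (i <= k)%N -> P i n.
Proof.
move=> /choice[N HN]; exists (\max_(i < k.+1) N i) => n Nn i ik; apply: HN.
by apply: leq_trans Nn; exact: (leq_bigmax (Ordinal (ik : (i < k.+1)%N))).
Qed.

Lemma power_polish : polish_psm rho -> polish_psm power_dist.
Proof.
move=> [rP rs rc rm]; split.
- split=> [n x|n x y|n x y z]; rewrite /power_dist.
  + exact: (psm_refl rP).
  + exact: (psm_sym rP).
  + exact: (psm_trian rP).
- move=> x y xy; apply/funext => i; apply: rs => n.
  by have := xy (pickle (i, n)); rewrite /power_dist pickleK.
- move=> u cu.
  have /choice[l Hl] : forall i, exists l, forall m, exists N, forall n,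
      (N <= n)%N -> pball rho m l (u n i).
    move=> i; apply: rc => m; have [k Hk] := pball_power_coord m i.
    by have [N HN] := cu k; exists N => n n' Nn Nn'; apply: Hk; exact: HN.
  exists l => m; have [k Hk] := pball_power m.
  have [N HN] := @eventually_all (fun i n => pball rho k (l i) (u n i)) k (Hl^~ k).
  by exists N => n Nn; apply: Hk; exact: HN.
- move=> m; have [k Hk] := pball_power m; have [phi Hphi] := rm k.
  exists (fun x => pickle (mkseq (phi \o x) k.+1)) => x y /(pcan_inj pickleK) xy.
  apply: Hk => i ik; apply: Hphi.
  by have := congr1 (fun s => nth 0%N s i) xy; rewrite !nth_mkseq.
Qed.

End Power.

Section Subspace.
Context {R : realType} {T : Type}.
Variables (rho : nat -> T -> T -> R) (S : set T).

Definition sub_dist n (x y : {x | S x}) : R := rho n (sval x) (sval y).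

Lemma sub_polish : polish_psm rho ->
  (forall l, (forall m, exists2 x, S x & pball rho m l x) -> S l) ->
  polish_psm sub_dist.
Proof.
move=> [rP rs rc rm] clS; split.
- split=> [n x|n x y|n x y z]; rewrite /sub_dist.
  + exact: (psm_refl rP).
  + exact: (psm_sym rP).
  + exact: (psm_trian rP).
- by move=> [x Sx] [y Sy] xy; exact/eq_exist/rs.
- move=> u cu; have [m|l Hl] := rc (sval \o u); first exact: cu.
  have Sl : S l.
    apply: clS => m; have [N HN] := Hl m; exists (sval (u N)); first exact: svalP.
    exact: HN.
  by exists (exist _ l Sl).
- by move=> m; have [phi H] := rm m; exists (phi \o sval) => x y /H.
Qed.

End Subspace.

Lemma baire_polish_psm (R : realType) :
  polish_psm (power_dist (discrete_dist R nat)).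
Proof. exact/power_polish/discrete_polish. Qed.

Definition baire_psmSpace (R : realType) : psmSpace R :=
  PsmSpace (let: And4 h _ _ _ := baire_polish_psm R in h).

Definition baire (R : realType) : topologicalType := psm_type (baire_psmSpace R).

Lemma baire_polish (R : realType) : polish R (baire R).
Proof. exact/polish_psm_type/baire_polish_psm. Qed.

Lemma baire_nbhsP (R : realType) (x : baire R) (A : set (baire R)) :
  nbhs x A <-> exists n, forall y : nat -> nat,
    mkseq (x : nat -> nat) n = mkseq y n -> A y.
Proof.
split=> [[m mA]|[n nA]].
  have [k Hk] := pball_power (discrete_dist R nat) m.
  exists k.+1 => y xy; apply: mA; apply: Hk => i ik; apply/discrete_pballE.
  by have := congr1 (fun s => nth 0%N s i) xy; rewrite !nth_mkseq.
have /choice[k Hk] := pball_power_coord (discrete_dist R nat) 0.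
exists (\max_(i < n) k i) => y xy; apply: nA.
apply: (@eq_from_nth _ 0%N); rewrite ?size_mkseq// => i ik.
rewrite !nth_mkseq//; apply/(@discrete_pballE R _ 0); apply: Hk.
by apply: pball_le xy; exact: (leq_bigmax (Ordinal ik)).
Qed.

(** * Closed spans of sequences of functions, and Borel maps into the space of
    closed subspaces *)

Section ClosedSpan.
Context {R : realType}.
Implicit Types (g : nat -> Creal R) (c : seq (rat * nat)) (f u v : Creal R).

Definition rat_comb g c : Creal R := \sum_(x <- c) ratr x.1 *: g x.2.

Definition cspan_set g : set (Creal R) := closure (range (rat_comb g)).

Lemma cspan_setP g f :
  cspan_set g f <-> forall m e, 0 < e -> exists c, cnorm m (f - rat_comb g c) < e.
Proof.
split=> [clf m e /exists_inv_natS_lt[k ke]|H A /cnorm_generates[m mA]].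
  have [_ [[c _ <-] fc]] := clf _ (pball_nbhs cnorm_generates (maxn m k) f).
  exists c; apply: lt_trans ke.
  exact: lt_le_trans (fc _ (leq_maxl m k)) (inv_natS_le (leq_maxr m k)).
have [|c Hc] := H m m.+1%:R^-1; first by rewrite invr_gt0 ltr0n.
exists (rat_comb g c); split; first by exists c.
by apply: mA; exact/(seminorm_pballE cnorm_seminorms).
Qed.

Lemma exists_ratr_near (a e : R) : 0 < e -> exists q : rat, `|a - ratr q| < e.
Proof.
move=> e0; have ae : a < a + e by rewrite ltrDl.
have [q] := rat_in_itvoo ae; rewrite in_itv/= => /andP[aq qa]; exists q.
by rewrite distrC ger0_norm ?subr_ge0 ?ltW// ltrBlDl.
Qed.

Lemma rat_comb_cat g c c' : rat_comb g (c ++ c') = rat_comb g c + rat_comb g c'.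
Proof. by rewrite /rat_comb big_cat. Qed.

Lemma rat_comb_scale g c (q : rat) :
  rat_comb g [seq (q * x.1, x.2) | x <- c] = ratr q *: rat_comb g c.
Proof.
rewrite /rat_comb big_map scaler_sumr; apply: eq_bigr => x _ /=.
by rewrite scalerA rmorphM.
Qed.

(** The rational combinations are not stable under real scalings, but a real
    multiple of a combination is approximated by its rational multiples. *)
Lemma cspan_submod_closed g : submod_closed [in cspan_set g].
Proof.
have nP := @cnorm_seminorms R.
split=> [|a u v /set_mem/cspan_setP ug /set_mem/cspan_setP vg].
  apply/mem_set/cspan_setP => m e e0; exists [::].
  by rewrite /rat_comb big_nil subr0 (seminorm0 nP).
apply/mem_set/cspan_setP => m e e0.
have e30 : 0 < e / 3 by rewrite divr_gt0.
have [|c uc] := ug m (e / 3 / (`|a| + 1)); first by rewrite divr_gt0// ltr_wpDl.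
have [|d vd] := vg m (e / 3); first by [].
have n0 : 0 < cnorm m (rat_comb g c) + 1 by rewrite ltr_wpDl// (seminorm_ge0 nP).
have [|q aq] := @exists_ratr_near a (e / 3 / (cnorm m (rat_comb g c) + 1)).
  by rewrite divr_gt0.
exists ([seq (q * x.1, x.2) | x <- c] ++ d).
rewrite rat_comb_cat rat_comb_scale.
have -> : a *: u + v - (ratr q *: rat_comb g c + rat_comb g d) =
   a *: (u - rat_comb g c) + (a - ratr q) *: rat_comb g c + (v - rat_comb g d).
  by rewrite scalerBr scalerBl subrKA opprD addrACA.
apply: le_lt_trans (seminormD nP _ _ _) _.
have := seminormD nP m (a *: (u - rat_comb g c)) ((a - ratr q) *: rat_comb g c).
rewrite !(seminormZ nP).
have : `|a| * cnorm m (u - rat_comb g c) <= e / 3.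
  apply: (@le_trans _ _ ((`|a| + 1) * cnorm m (u - rat_comb g c))).
    by rewrite ler_wpM2r ?(seminorm_ge0 nP)// lerDl.
  by rewrite mulrC -ler_pdivlMr ?ltr_wpDl// ltW.
have : `|a - ratr q| * cnorm m (rat_comb g c) <= e / 3.
  apply: (@le_trans _ _ (`|a - ratr q| * (cnorm m (rat_comb g c) + 1))).
    by rewrite ler_wpM2l// lerDl.
  by rewrite -ler_pdivlMr// ltW.
by move: vd; lra.
Qed.

Definition cspan g : closed_subspace (Creal R) :=
  ClosedSubspace (@closed_closure _ (range (rat_comb g))) (cspan_submod_closed g).

Lemma cspan_gen g n : cspan_set g (g n).
Proof.
apply: subset_closure; exists [:: (1, n)] => //.
by rewrite /rat_comb big_seq1 rmorph1 scale1r.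
Qed.

Lemma cspan_sub g (W : set (Creal R)) : closed W -> W 0 ->
  (forall a n u, W u -> W (a *: g n + u)) -> cspan_set g `<=` W.
Proof.
move=> clW W0 Wg.
suff : cspan_set g `<=` closure W by rewrite -((closure_id W).1 clW).
apply: closureS => _ [c _ <-]; rewrite /rat_comb.
by elim: c => [|x c IH]; rewrite ?big_nil ?big_cons//; exact: Wg.
Qed.

Lemma cspan_least g (X : closed_subspace (Creal R)) :
  (forall n, (X : set _) (g n)) -> cspan_set g `<=` X.
Proof.
have [X0 XD] := @subspace_submod _ _ X.
move=> Xg; apply: cspan_sub; first exact: (@subspace_closed _ _ X).
  exact/set_mem.
by move=> a n u Xu; apply/set_mem/XD; exact/mem_set.
Qed.

Lemma cspan_hit g (U : set (Creal R)) : open U ->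
  (cspan_set g `&` U !=set0) <-> exists c, U (rat_comb g c).
Proof.
move=> oU; split=> [[f [clf Uf]]|[c Uc]].
  by have [_ [[c _ <-] Uc]] := clf U (open_nbhs_nbhs (conj oU Uf)); exists c.
by exists (rat_comb g c); split => //; apply: subset_closure; exists c.
Qed.

End ClosedSpan.

(** The countable base of the topology shows that a closed subspace is
    determined by countably many of the sets that generate the Effros structure,
    and that it has a dense sequence. *)
Definition creal_base (R : realType) : nat -> set (Creal R) :=
  sval (cid (psm_countable_base (seminorm_distP (@cnorm_seminorms R))
    (@cnorm_generates R) (@cnorm_small R))).
Arguments creal_base R : clear implicits.

Section CrealBase.
Context {R : realType}.

Lemma creal_base_open i : open (creal_base R i).
Proof. by rewrite /creal_base; case: cid => U []. Qed.

Lemma creal_baseP (f : Creal R) (A : set (Creal R)) :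
  nbhs f A -> exists i, creal_base R i f /\ creal_base R i `<=` A.
Proof. by rewrite /creal_base; case: cid => U [_ /=]; exact. Qed.

Lemma closed_subspace_inj (X X' : closed_subspace (Creal R)) :
  (X : set (Creal R)) = X' -> X = X'.
Proof.
case: X X' => [A clA mA] [B clB mB] /= AB; case: _ / AB clB mB => clB mB.
by congr ClosedSubspace; exact: Prop_irrelevance.
Qed.

Lemma closed_subspace_eq (X X' : closed_subspace (Creal R)) :
  (forall i, (X : set _) `&` creal_base R i !=set0 <->
             (X' : set _) `&` creal_base R i !=set0) -> X = X'.
Proof.
have H (Y Y' : closed_subspace (Creal R)) :
  (forall i, (Y : set _) `&` creal_base R i !=set0 ->
             (Y' : set _) `&` creal_base R i !=set0) -> (Y : set _) `<=` Y'.
  move=> YY' f Yf; apply: (@subspace_closed _ _ Y') => A fA.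
  have [i [fi iA]] := creal_baseP fA.
  have [|h [Yh hi]] := YY' i; first by exists f.
  by exists h; split => //; exact: iA.
move=> XX'; apply: closed_subspace_inj; apply/seteqP.
by split; apply: H => i /XX'.
Qed.

Lemma closed_subspace_cspan (X : closed_subspace (Creal R)) :
  exists g : nat -> Creal R, X = cspan g.
Proof.
have [/set_mem X0 _] := @subspace_submod _ _ X.
pose g i := xget (0 : Creal R) ((X : set _) `&` creal_base R i).
have Xg i : (X : set _) (g i) by rewrite /g; case: xgetP => // f _ [].
exists g; apply: closed_subspace_inj; apply/seteqP; split; last exact: cspan_least.
move=> f Xf A fA; have [i [fi iA]] := creal_baseP fA.
have : ((X : set _) `&` creal_base R i) (g i).
  by apply: (@xgetPex _ (0 : Creal R)); exists f.
move=> [_ gi]; exists (g i); split; last exact: iA.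
by exists [:: (1, i)] => //; rewrite /rat_comb big_seq1 rmorph1 scale1r.
Qed.

End CrealBase.

Definition borel (Z : topologicalType) : set (set Z) := <<s [set U : set Z | open U] >>.

Section Borel.
Context {Z : topologicalType}.
Implicit Types A : set Z.

Lemma borel_open A : open A -> borel A.
Proof. by move=> oA; exact: sub_sigma_algebra. Qed.

Lemma borelC A : borel A -> borel (~` A).
Proof. by have [_ + _] := smallest_sigma_algebra setT [set U : set Z | open U];
  move=> /[apply]; rewrite setTD. Qed.

Lemma borel_bigcup (F : nat -> set Z) :
  (forall i, borel (F i)) -> borel (\bigcup_i F i).
Proof. by have [_ _ +] := smallest_sigma_algebra setT [set U : set Z | open U]; exact. Qed.

Lemma borel_closed A : closed A -> borel A.
Proof.
move=> clA; rewrite -[A]setCK; apply: borelC; apply: borel_open.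
exact: closed_openC.
Qed.

Lemma borelU A B : borel A -> borel B -> borel (A `|` B).
Proof.
move=> bA bB; rewrite -bigcup2E; apply: borel_bigcup => -[|[|i]]//=.
by apply: borel_open; exact: open0.
Qed.

Lemma borelI A B : borel A -> borel B -> borel (A `&` B).
Proof.
move=> bA bB; rewrite -[A]setCK -[B]setCK -setCU.
by apply: borelC; apply: borelU; exact: borelC.
Qed.

Lemma borel_countable_exists (C : countType) (P : C -> set Z) :
  (forall c, borel (P c)) -> borel [set z | exists c, P c z].
Proof.
move=> bP; rewrite [X in borel X](_ : _ =
    \bigcup_i (if unpickle i is Some c then P c else set0)).
  by apply: borel_bigcup => i; case: unpickle => // ; apply: borel_open; exact: open0.
apply/seteqP; split=> [z [c Pc]|z [i _]]; first by exists (pickle c); rewrite ?pickleK.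
by case: unpickle => // c Pc; exists c.
Qed.

(** It suffices to check the preimages of the generators of the Effros
    structure, and a closed span hits an open set if and only if one of countably
    many combinations belongs to it. *)
Lemma borel_map_cspan (R : realType) (G : Z -> nat -> Creal R) :
  (forall c U, open U -> borel [set z | U (rat_comb (G z) c)]) ->
  borel_map (fun z => cspan (G z) : SF R).
Proof.
move=> bG; rewrite /borel_map.
suff : <<s @hit_sets R (Creal R) >> `<=` [set A | borel ((fun z => cspan (G z)) @^-1` A)].
  by [].
apply: smallest_sub.
  split=> /= [|A bA|F bF].
  - by rewrite preimage_set0; apply: borel_open; exact: open0.
  - by rewrite setTD preimage_setC; exact: borelC.
  - by rewrite preimage_bigcup; exact: borel_bigcup.
move=> _ [U oU <-] /=.
rewrite [X in borel X](_ : _ = [set z | exists c, U (rat_comb (G z) c)]).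
  by apply: borel_countable_exists => c; exact: bG.
by apply/seteqP; split=> z /= /(cspan_hit (G z) oU).
Qed.

End Borel.

(** * The Montel subspaces form a coanalytic set *)

Section Coanalytic.
Context {R : realType}.

(** A sequence of pairs [(g n, M n)] witnesses that the closed span of the [g n]
    is not Montel if its terms of even index form a bounded sequence that has no
    Cauchy subsequence. *)
Definition nonmontel_witness (w : nat -> Creal R * nat) :=
  (forall n i, cnorm n (w i.*2).1 <= (w n).2%:R) /\
  (forall i j, i <> j -> 1 <= cnorm (w 0%N).2 ((w i.*2).1 - (w j.*2).1)).

Lemma cnorm_polish : polish_psm (seminorm_dist (@cnorm R)).
Proof.
split; [exact/seminorm_distP/cnorm_seminorms|exact: cnorm_separating|
  exact: cnorm_complete|exact: cnorm_small].
Qed.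

Definition witness_dist :=
  power_dist (prod_dist (seminorm_dist (@cnorm R)) (discrete_dist R nat)).

Lemma nonmontel_witness_closed w :
  (forall m, exists2 w', nonmontel_witness w' & pball witness_dist m w w') ->
  nonmontel_witness w.
Proof.
have nP := @cnorm_seminorms R.
move=> clw.
have near_w (s : seq nat) m e : 0 < e -> exists2 w', nonmontel_witness w' &
    forall k, k \in s -> cnorm m ((w k).1 - (w' k).1) < e /\ (w k).2 = (w' k).2.
  move=> /exists_inv_natS_lt[l le].
  have /choice[K HK] := pball_power_coord
    (prod_dist (seminorm_dist (@cnorm R)) (discrete_dist R nat)) (maxn m l).
  have [w' w'P ww'] := clw (\max_(k <- s) K k).
  exists w' => // k ks.
  have /HK/prod_pballE[/(_ m (leq_maxl m l)) kw /discrete_pballE//] :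
      pball witness_dist (K k) w w'.
    by apply: pball_le ww'; exact: leq_bigmax_seq.
  move=> ->; split=> //; apply: lt_trans le.
  exact: lt_le_trans kw (inv_natS_le (leq_maxr m l)).
split=> [n i|i j ij].
  apply/ler_addgt0Pr => e e0.
  have [w' [w'b _] ww'] := near_w [:: n; i.*2] n e e0.
  have [_ ->] := ww' n (mem_head _ _).
  have [d _] := ww' i.*2 (mem_last n [:: i.*2]).
  rewrite -[(w i.*2).1](subrK (w' i.*2).1) addrC.
  by rewrite (le_trans (seminormD nP _ _ _))// lerD// ltW.
apply/ler_addgt0Pr => e e0; have e20 : 0 < e / 2 by rewrite divr_gt0.
have [w' [_ w's] ww'] := near_w [:: 0%N; i.*2; j.*2] (w 0%N).2 (e / 2) e20.
have [_ M0] := ww' 0%N (mem_head _ _); have := w's i j ij; rewrite -M0.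
have /ww'[di _] : i.*2 \in [:: 0%N; i.*2; j.*2] by rewrite !inE eqxx orbT.
have /ww'[dj _] : j.*2 \in [:: 0%N; i.*2; j.*2] by rewrite !inE eqxx !orbT.
rewrite -(seminormN nP) opprB in di.
have -> : (w' i.*2).1 - (w' j.*2).1 = ((w i.*2).1 - (w j.*2).1) +
    (((w' i.*2).1 - (w i.*2).1) + ((w j.*2).1 - (w' j.*2).1)).
  by rewrite addrCA subrKA subrKA.
move=> H; apply: le_trans H _; apply: le_trans (seminormD nP _ _ _) _.
rewrite lerD2l; apply: le_trans (seminormD nP _ _ _) _.
by rewrite [leRHS]splitr lerD// ltW.
Qed.

Lemma witness_polish_psm :
  polish_psm (sub_dist witness_dist (S := nonmontel_witness)).
Proof.
apply: sub_polish nonmontel_witness_closed; apply: power_polish.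
by apply: prod_polish; [exact: cnorm_polish|exact: discrete_polish].
Qed.

Definition witness_psmSpace : psmSpace R :=
  PsmSpace (let: And4 h _ _ _ := witness_polish_psm in h).

Definition witness_seq (w : psm_type witness_psmSpace) (n : nat) : Creal R :=
  (sval w n).1.

Lemma witness_seq_continuous n : continuous (witness_seq^~ n).
Proof.
apply: (@psm_continuous R (psm_type witness_psmSpace) (Creal R) _ _ _
  (@psm_type_generates R witness_psmSpace) cnorm_generates).
move=> m; have [k Hk] := pball_power_coord
  (prod_dist (seminorm_dist (@cnorm R)) (discrete_dist R nat)) m n.
by exists k => x y /Hk/prod_pballE[].
Qed.

Lemma continuous_addZ (Z : topologicalType) (F G : Z -> Creal R) a :
  continuous F -> continuous G -> continuous (fun z => a *: F z + G z).
Proof.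
move=> cF cG z.
apply: (@continuous_comp _ _ _ (fun v => (a *: F v, G v)) (fun p => p.1 + p.2)).
  apply: (@cvg_pair _ _ _ _ (nbhs (a *: F z)) (nbhs (G z))); last exact: cG.
  apply: (@continuous_comp _ _ _ (fun v => ((a : R^o), F v)) (fun p => p.1 *: p.2)).
    apply: (@cvg_pair _ _ _ _ (nbhs (a : R^o)) (nbhs (F z))); last exact: cF.
    exact: cvg_cst.
  exact: scale_continuous.
exact: add_continuous.
Qed.

Lemma rat_comb_continuous (Z : topologicalType) (G : Z -> nat -> Creal R) c :
  (forall n, continuous (G^~ n)) -> continuous (fun z => rat_comb (G z) c).
Proof.
move=> cG; elim: c => [|x c IH].
  rewrite (_ : (fun=> _) = cst 0); first exact: cst_continuous.
  by apply/funext => z; rewrite /rat_comb big_nil.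
rewrite (_ : (fun=> _) = fun z => ratr x.1 *: G z x.2 + rat_comb (G z) c); last first.
  by apply/funext => z; rewrite /rat_comb big_cons.
exact: continuous_addZ.
Qed.

Lemma not_montel_cspan (w : psm_type witness_psmSpace) :
  ~ Mon R (cspan (witness_seq w) : SF R).
Proof.
have [wb ws] := svalP w; apply/not_montel_subspaceP.
exists (fun i => witness_seq w i.*2), (fun n => (sval w n).2).
by split => // i; exact: cspan_gen.
Qed.

Lemma not_montel_witness (X : closed_subspace (Creal R)) :
  ~ montel_space (subspace_type X) ->
  exists w : psm_type witness_psmSpace, X = cspan (witness_seq w).
Proof.
move=> /not_montel_subspaceP[f [M [Xf fM fsep]]].
have [g gX] := closed_subspace_cspan X.
(* even terms form the given sequence, odd terms span a dense subspace *)
pose w n := ((if odd n then g n./2 else f n./2), M n).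
have wP : nonmontel_witness w.
  by split=> [n i|i j ij]; rewrite /w /= !odd_double !doubleK; [exact: fM|exact: fsep].
exists (exist _ w wP); apply: closed_subspace_inj; apply/seteqP; split.
  rewrite [in X in X `<=` _]gX; apply: cspan_least => n.
  by have := @cspan_gen R (witness_seq (exist _ w wP)) n.*2.+1;
    rewrite /witness_seq/= odd_double/= uphalf_double.
apply: cspan_least => n; rewrite /witness_seq/=; case: ifP => _ //.
by rewrite gX; exact: cspan_gen.
Qed.

Theorem montel_coanalytic : coanalytic R (Mon R).
Proof.
exists (psm_type witness_psmSpace); first exact/polish_psm_type/witness_polish_psm.
exists (fun w => cspan (witness_seq w)).
  apply: borel_map_cspan => c U oU; apply: borel_open.
  have /continuousP := rat_comb_continuous (c := c) witness_seq_continuous.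
  exact.
apply/seteqP; split=> [_ [w _ <-]|X nX]; first exact: not_montel_cspan.
by have [w ->] := not_montel_witness nX; exists w.
Qed.

End Coanalytic.

(** * Suslin sets *)

(** The result of the Suslin operation applied to closed sets. Every analytic
    set has this form, and this form is stable under countable unions and
    intersections by a mere coding of sequences of integers. *)
Definition suslin (Z : topologicalType) (A : set Z) :=
  exists2 F : seq nat -> set Z, (forall s, closed (F s)) &
    forall z, A z <-> exists x : nat -> nat, forall n, F (mkseq x n) z.

Section Suslin.
Context {Z : topologicalType}.
Implicit Types A : set Z.

Lemma take_mkseq T (x : nat -> T) m n : (m <= n)%N -> take m (mkseq x n) = mkseq x m.
Proof. by move=> mn; rewrite /mkseq -map_take take_iota (minn_idPl mn). Qed.

(** It is enough to intersect the closed sets along the initial segments. *)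
Lemma suslin_decreasing A : suslin A ->
  exists F : seq nat -> set Z, [/\ forall s, closed (F s),
    forall s n, F s `<=` F (take n s) &
    forall z, A z <-> exists x : nat -> nat, forall n, F (mkseq x n) z].
Proof.
move=> [F clF AF]; exists (fun s => \bigcap_n F (take n s)); split.
- by move=> s; apply: closed_bigI => n _; exact: clF.
- move=> s n z Fz m _ /=; rewrite -take_min; exact: Fz.
- move=> z; split=> [/AF[x xF]|[x xF]].
    exists x => n m _; have [mn|nm] := leqP m n; first by rewrite take_mkseq.
    by rewrite take_oversize ?size_mkseq 1?ltnW.
  apply/AF; exists x => n; have := xF n n Logic.I.
  by rewrite take_oversize ?size_mkseq.
Qed.

Lemma suslin_closed A : closed A -> suslin A.
Proof.
move=> clA; exists (fun=> A) => // z; split=> [Az|[x /(_ 0%N)//]].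
by exists (fun=> 0%N).
Qed.

Lemma suslin_bigcup (A : nat -> set Z) :
  (forall i, suslin (A i)) -> suslin (\bigcup_i A i).
Proof.
move=> /(_ _)/cid2-/all_sig2[F clF AF].
pose G s := if s is i :: s' then F i s' else setT.
exists G.
  by case=> [|i s]; [exact: closedT|exact: clF].
have mkseq_cons (x : nat -> nat) n :
    mkseq x n.+1 = x 0%N :: mkseq (fun k => x k.+1) n.
  by rewrite /mkseq/= -[1%N]/(1 + 0)%N iotaDl -map_comp.
move=> z; split=> [[i _ /AF[x xF]]|[x xF]].
  exists (fun n => if n is k.+1 then x k else i) => -[//|n].
  by rewrite mkseq_cons /G; exact: xF.
exists (x 0%N) => //; apply/AF; exists (fun k => x k.+1) => n.
by have := xF n.+1; rewrite mkseq_cons /G.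
Qed.

(** A sequence [x] codes the sequences [fun k => x (pickle (i, k))]; a finite
    initial segment of [x] decides initial segments of finitely many of them. *)
Lemma suslin_bigcap (A : nat -> set Z) :
  (forall i, suslin (A i)) -> suslin (\bigcap_i A i).
Proof.
move=> /(_ _)/cid2-/all_sig2[F clF AF].
pose D (s : seq nat) (p : nat * nat) :=
  forall k, (k < p.2)%N -> (pickle (p.1, k) < size s)%N.
pose G s := \bigcap_(p in D s) F p.1 (mkseq (fun k => nth 0%N s (pickle (p.1, k))) p.2).
exists G; first by move=> s; apply: closed_bigI => p _; exact: clF.
move=> z; split=> [Az|[x xG] i _].
  have /choice[x xF] : forall i, exists x : nat -> nat, forall n, F i (mkseq x n) z.
    by move=> i; apply/AF; exact: Az.
  pose y n := if unpickle n is Some p then x p.1 p.2 else 0%N.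
  exists y => n [i m] Dim /=.
  rewrite (_ : mkseq _ m = mkseq (x i) m); first exact: xF.
  apply: (@eq_from_nth _ 0%N); rewrite !size_mkseq// => k km.
  rewrite !nth_mkseq//; last by have := Dim k km; rewrite size_mkseq.
  by rewrite /y pickleK.
apply/AF; exists (fun k => x (pickle (i, k))) => n.
pose N := (\max_(k < n) pickle (i, nat_of_ord k)).+1.
have DN : D (mkseq x N) (i, n).
  move=> k kn; rewrite size_mkseq ltnS.
  exact: (leq_bigmax (F := fun k : 'I_n => pickle (i, nat_of_ord k)) (Ordinal kn)).
have := xG N (i, n) DN => /=.
rewrite (_ : mkseq _ n = mkseq (fun k => x (pickle (i, k))) n)//.
apply: (@eq_from_nth _ 0%N); rewrite !size_mkseq// => k kn.
by rewrite !nth_mkseq//; have := DN k kn; rewrite size_mkseq.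
Qed.

Lemma suslinU A B : suslin A -> suslin B -> suslin (A `|` B).
Proof.
move=> sA sB; rewrite -bigcup2E; apply: suslin_bigcup => -[|[|i]]//=.
exact/suslin_closed/closed0.
Qed.

Lemma suslinI A B : suslin A -> suslin B -> suslin (A `&` B).
Proof.
move=> sA sB; rewrite -bigcap2E; apply: suslin_bigcap => -[|[|i]]//=.
exact/suslin_closed/closedT.
Qed.

Lemma suslin_preimage (Y : topologicalType) (f : Y -> Z) A :
  continuous f -> suslin A -> suslin (f @^-1` A).
Proof.
move=> cf [F clF AF]; exists (fun s => f @^-1` F s); last by move=> y; exact: AF.
by move=> s; apply: closed_comp (clF s) => y _; exact: cf.
Qed.

(** In a metrizable space an open set is a countable union of closed sets, so
    that the sets that are Suslin together with their complement form a sigma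
    algebra containing the open sets. *)
Lemma borel_suslin (R : realType) (d : Z -> Z -> R) A :
  metrizes d -> borel A -> suslin A.
Proof.
move=> [dP dZ] bA.
have open_suslin (U : set Z) : open U -> suslin U.
  move=> oU; pose C m := [set z | forall w, d z w < m.+1%:R^-1 -> U w].
  have -> : U = \bigcup_m C m.
    apply/seteqP; split=> [z Uz|z [m _]].
      have /dZ[e /exists_inv_natS_lt[m me] eU] := open_nbhs_nbhs (conj oU Uz).
      by exists m => // w zw; apply: eU; exact: lt_trans me.
    by apply; rewrite (metric_refl dP) invr_gt0 ltr0n.
  apply: suslin_bigcup => m; apply: suslin_closed => z clz w zw.
  have e0 : 0 < m.+1%:R^-1 - d z w by rewrite subr_gt0.
  have [|v [Cv zv]] := clz [set v | d z v < m.+1%:R^-1 - d z w].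
    by apply/dZ; exists (m.+1%:R^-1 - d z w).
  apply: Cv; apply: le_lt_trans (metric_trian dP v z w) _.
  by rewrite (metric_symm dP) -ltrBrDr.
suff /(_ A bA)[] : @borel Z `<=` [set A : set Z | suslin A /\ suslin (~` A)] by [].
apply: smallest_sub.
  split=> /= [|B [sB sCB]|F sF].
  - split; first exact/suslin_closed/closed0.
    by rewrite setC0; exact/suslin_closed/closedT.
  - by rewrite setTD setCK.
  - split; first by apply: suslin_bigcup => i; exact: (sF i).1.
    by rewrite setC_bigcup; apply: suslin_bigcap => i; exact: (sF i).2.
move=> U oU; split; first exact: open_suslin.
by apply: suslin_closed; exact: open_closedC.
Qed.

End Suslin.

(** A Polish space is cut, for each [m], into countably many pieces of diameter
    less than [m.+1%:R^-1]; a point is coded by the pieces that contain it. *)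
Lemma polish_pieces (R : realType) (Y : topologicalType) : polish R Y ->
  exists (d : Y -> Y -> R) (phi : nat -> Y -> nat), [/\ metrizes d,
    complete_metric d & forall m x y, phi m x = phi m y -> d x y < m.+1%:R^-1].
Proof.
move=> [[D /countable_injP[f finj] denD] [d [[dP dY] dc]]]; exists d.
suff /choice[phi Hphi] : forall m, exists phi : Y -> nat, forall x y,
    phi x = phi y -> d x y < m.+1%:R^-1.
  by exists phi; split.
move=> m; pose e : R := m.+1%:R^-1 / 2.
have e0 : 0 < e by rewrite divr_gt0// invr_gt0 ltr0n.
have /choice[c Hc] : forall y, exists x, D x /\ d y x < e.
  move=> y; pose A := [set x | d y x < e].
  have : nbhs y A by apply/dY; exists e.
  rewrite nbhsE => -[U [oU Uy] UA].
  have [|x [Ux Dx]] := denD U _ oU; first by exists y.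
  by exists x; split=> //; exact: UA.
exists (f \o c) => x y /= fxy.
have cxy : c x = c y by apply: finj => //; apply/mem_set; exact: (Hc _).1.
apply: le_lt_trans (metric_trian dP x (c x) y) _.
rewrite [ltRHS]splitr ltrD//; first exact: (Hc _).2.
by rewrite cxy (metric_symm dP); exact: (Hc _).2.
Qed.

Section Projection.
Context {R : realType} {Y Z : topologicalType}.

(** Points chosen in the sets [E n] have first coordinates that form a Cauchy
    sequence; since the whole projection of [E n] to [Y] is small, its limit is
    adherent to it no matter which points of [E n] have to be taken to approach
    [z]. *)
Lemma closure_projection (d : Y -> Y -> R) (phi : nat -> Y -> nat) (u : nat -> nat)
    (E : nat -> set (Y * Z)) (z : Z) :
  metrizes d -> complete_metric d ->
  (forall m x y, phi m x = phi m y -> d x y < m.+1%:R^-1) ->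
  (forall m n, (m <= n)%N -> E n `<=` E m) ->
  (forall m n p, (m < n)%N -> E n p -> phi m p.1 = u m) ->
  (forall n, closure (snd @` E n) z) ->
  exists y, forall n, closure (E n) (y, z).
Proof.
move=> [dP dY] dc dphi decE Eu clE.
have /choice[p Ep] : forall n, exists p, E n p.
  by move=> n; have [_ [[p Ep _] _]] := clE n setT filterT; exists p.
have near m i j : (m < i)%N -> (m < j)%N -> d (p i).1 (p j).1 < m.+1%:R^-1.
  by move=> mi mj; apply: dphi; rewrite (Eu m i)// (Eu m j).
have [e /exists_inv_natS_lt[m me]|l ul] := dc (fun n => (p n).1).
  by exists m.+1 => i j mi mj; apply: lt_trans me; exact: near.
exists l => n A [[U V] /= [/dY[e e0 eU] Vz] UVA].
have e20 : 0 < e / 2 by rewrite divr_gt0.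
have [m me] := exists_inv_natS_lt e20.
have /ul[N _ HN] : nbhs l [set y | d l y < e / 2] by apply/dY; exists (e / 2).
pose k := (maxn n (maxn N m)).+1.
have [_ [[q Eq <-] Vq]] := clE k V Vz.
exists q; split; first by apply: decE Eq; rewrite leqW// leq_maxl.
apply: UVA; split=> //=; apply: eU => /=.
apply: le_lt_trans (metric_trian dP l (p k).1 q.1) _; rewrite [ltRHS]splitr.
have mk : (m < k)%N by rewrite ltnS !leq_max leqnn !orbT.
rewrite ltrD//; first by apply: HN; rewrite /= leqW// !leq_max leqnn orbT.
by apply: lt_trans me; apply: dphi; rewrite (Eu m k)// (Eu m k).
Qed.

Lemma suslin_projection (C : set (Y * Z)) : polish R Y -> suslin C ->
  suslin [set z | exists y, C (y, z)].
Proof.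
move=> /polish_pieces[d [phi [dY dc dphi]]] /suslin_decreasing[F [clF decF CF]].
(* a code [k] of a pair stands for a piece of [Y] and a branch of [F] *)
pose c k := odflt (0, 0)%N (unpickle k) : nat * nat.
pose s1 s := [seq (c k).1 | k <- s]; pose s2 s := [seq (c k).2 | k <- s].
pose V (s : seq nat) (y : Y) := forall i, (i < size s)%N -> phi i y = nth 0%N s i.
exists (fun s => closure [set z | exists y, V (s1 s) y /\ F (s2 s) (y, z)]).
  by move=> s; exact: closed_closure.
have s1E w n : s1 (mkseq w n) = mkseq (fun i => (c (w i)).1) n.
  by rewrite /s1 -map_comp.
have s2E w n : s2 (mkseq w n) = mkseq (fun i => (c (w i)).2) n.
  by rewrite /s2 -map_comp.
move=> z; split=> [[y /CF[x xF]]|[w Hw]].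
  exists (fun i => pickle (phi i y, x i)) => n; apply: subset_closure.
  exists y; rewrite s1E s2E; split.
    by move=> i; rewrite size_mkseq => ik; rewrite nth_mkseq// /c pickleK.
  have -> : (fun i => (c (pickle (phi i y, x i))).2) = x.
    by apply/funext => i; rewrite /c pickleK.
  exact: xF.
pose E n := [set p : Y * Z | V (s1 (mkseq w n)) p.1 /\ F (s2 (mkseq w n)) p].
have [|||y yE] := @closure_projection d phi (fun i => (c (w i)).1) E z dY dc dphi.
- move=> m n mn p [Vp Fp]; split.
    move=> i; rewrite s1E size_mkseq => im.
    rewrite nth_mkseq// Vp; first by rewrite s1E nth_mkseq// (leq_trans im).
    by rewrite s1E size_mkseq (leq_trans im).
  by have := decF _ m _ Fp; rewrite !s2E take_mkseq.
- move=> m n p mn [Vp _]; rewrite Vp; last by rewrite s1E size_mkseq.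
  by rewrite s1E nth_mkseq.
- move=> n; apply: closureS (Hw n) => z' [y [Vy Fy]].
  by exists (y, z').
exists y; apply/CF; exists (fun i => (c (w i)).2) => n.
rewrite -s2E; apply: clF; apply: closureS (yE n) => p [].
by [].
Qed.

End Projection.

(** An analytic set is the projection of a graph, which is closed. *)
Lemma analytic_suslin (R : realType) (Z : topologicalType) (A : set Z) :
  polish R Z -> polish_analytic R A -> suslin A.
Proof.
move=> [_ [dZ [[dP dT] _]]] [Y pY [h ch <-]].
have clh : closed [set p : Y * Z | h p.1 = p.2].
  move=> [y z] clp /=; apply: (metric_eq dP); apply/eqP; rewrite eq_le.
  apply/andP; split; last first.
    have := metric_trian dP z (h y) z.
    by rewrite (metric_refl dP) (metric_symm dP z) -mulr2n pmulrn_lge0.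
  apply/ler_addgt0Pr => e e0; rewrite add0r.
  have e20 : 0 < e / 2 by rewrite divr_gt0.
  have [|[y' z'] [/= <- [/= hy' zz']]] :=
      clp [set p | dZ (h y) (h p.1) < e / 2 /\ dZ z p.2 < e / 2].
    exists (h @^-1` [set w | dZ (h y) w < e / 2], [set w | dZ z w < e / 2]) => //=.
    split; last by apply/dT; exists (e / 2).
    by apply: ch; apply/dT; exists (e / 2).
  apply: ltW; apply: le_lt_trans (metric_trian dP (h y) (h y') z) _.
  by rewrite [ltRHS]splitr ltrD// (metric_symm dP).
have := suslin_projection pY (suslin_closed clh).
rewrite (_ : [set z | _] = range h)//.
by apply/seteqP; split=> z [y] => [/= hy|_ hy]; exists y.
Qed.

(** * Functions indexed by the finite sequences of integers *)

Section Bump.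
Context {R : realType}.
Implicit Types (s : seq nat) (t u : R).

(** The peaks accumulate at 0 only, so that infinitely many disjoint tents fit in
    the range of the sine. *)
Definition peak s : R := 2 ^- pickle s.

Definition tent s u : R := Num.max 0 (1 - `|4 * (2 ^+ pickle s * u) - 4|).

(** The shift by 2 makes the growth equal to 1 at the points [base s], which are
    at most [pi / 2]. The sum stops after the term of index [size s], where the
    initial segment is [s] itself. *)
Definition slope s t : R :=
  \sum_(0 <= j < (size s).+1) (pickle (take j s))%:R * Num.max 0 (t - (j + 2)%:R).

Definition growth s t : R := expR (slope s t).

Lemma tent_ge0 s u : 0 <= tent s u.
Proof. by rewrite le_max lexx. Qed.

Lemma tent_le1 s u : tent s u <= 1.
Proof. by rewrite ge_max ler01/= gerBl. Qed.

Lemma tent_peak s : tent s (peak s) = 1.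
Proof.
rewrite /tent /peak divff ?expf_neq0 ?pnatr_eq0// mulr1 subrr normr0 subr0.
by apply/max_idPr.
Qed.

(** The tent of [s] is positive for [2 ^+ pickle s * u] between 3/4 and 5/4 only,
    and doubling a number of this interval leaves the interval. *)
Lemma tent_disjoint s s' u : 0 < tent s u -> 0 < tent s' u -> s = s'.
Proof.
have H n n' : (n < n')%N -> 0 < 1 - `|4 * (2 ^+ n * u) - 4| ->
    0 < 1 - `|4 * (2 ^+ n' * u) - 4| -> False.
  move=> nn'; rewrite !subr_gt0 !ltr_norml => /andP[a1 a2] /andP[b1 b2].
  have u0 : 0 <= 2 ^+ n * u by lra.
  have : 2 * (2 ^+ n * u) <= 2 ^+ n' * u.
    rewrite -(subnK nn') exprD exprS -mulrA -(mulrA 2) -[leLHS]mul1r.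
    by rewrite ler_wpM2r ?exprn_ege1 ?ler1n// mulr_ge0.
  by lra.
rewrite !lt_max ltxx/= => su s'u; apply: (pcan_inj pickleK); apply/eqP.
by apply: contraT; rewrite neq_ltn => /orP[/H|/H] []; lra.
Qed.

Lemma tent_eq0 s s' u : 0 < tent s u -> s' <> s -> tent s' u = 0.
Proof.
move=> su s's; apply/eqP; rewrite eq_le tent_ge0 andbT leNgt; apply/negP => s'u.
by apply: s's; exact: tent_disjoint s'u su.
Qed.

Lemma slope_mono s t u : t <= u -> slope s t <= slope s u.
Proof.
move=> tu; apply: ler_sum => j _; rewrite ler_wpM2l// ge_max !le_max lexx/=.
by rewrite lerB ?orbT.
Qed.

Lemma slope_eq0 s t : t <= 2 -> slope s t = 0.
Proof.
move=> t2; apply: big1 => j _; rewrite (_ : Num.max _ _ = 0) ?mulr0//.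
apply/max_idPl; rewrite subr_le0 (le_trans t2)// natrD lerDr.
exact: ler0n.
Qed.

(** The terms of index at least [n] of the sum vanish up to [n]; this leaves
    finitely many initial segments of [x], whatever [i] is. *)
Lemma slope_le (x : nat -> nat) i n t : t <= n%:R ->
  slope (mkseq x i) t <= \sum_(0 <= j < n) (pickle (mkseq x j))%:R * n%:R.
Proof.
move=> tn; rewrite /slope size_mkseq.
have term j : (j < i.+1)%N -> (pickle (take j (mkseq x i)))%:R *
    Num.max 0 (t - (j + 2)%:R) <= (pickle (mkseq x j))%:R * n%:R :> R.
  rewrite ltnS => ji; rewrite take_mkseq// ler_wpM2l// ge_max ler0n/=.
  by rewrite lerBlDr (le_trans tn)// lerDl ler0n.
have [ni|ni] := leqP i.+1 n.
  rewrite [leRHS](big_cat_nat (leq0n _) ni)/=.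
  rewrite -[leLHS]addr0 lerD//; last by apply: sumr_ge0 => j _; rewrite mulr_ge0.
  by rewrite !big_nat; apply: ler_sum => j /andP[_]; exact: term.
rewrite (big_cat_nat (leq0n _) (ltnW ni))/=.
rewrite -[leRHS]addr0 lerD//.
  by rewrite !big_nat; apply: ler_sum => j /andP[_ jn]; apply: term; exact: ltn_trans ni.
rewrite big_nat big1// => j /andP[nj _]; rewrite (_ : Num.max _ _ = 0) ?mulr0//.
apply/max_idPl; rewrite subr_le0 (le_trans tn)// ler_nat.
by rewrite (leq_trans nj)// leq_addr.
Qed.

(** Every term of the sum is nondecreasing in the argument of the slope, and the
    factor [Num.max 0 (t - (j + 2))] of the [j]-th one grows by at least 1 from [m]
    to [k]. Beyond the length of [s], its last term, whose initial segment is [s]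
    itself, takes over. *)
Lemma slope_increase s j m k : (m < k)%N -> (j + 2 < k)%N ->
  (pickle (take j s))%:R <= slope s k%:R - slope s m%:R :> R.
Proof.
move=> mk jk.
wlog js : j jk / (j <= size s)%N.
  move=> H; have [js|sj] := leqP j (size s); first exact: H.
  rewrite take_oversize 1?ltnW// -[in X in pickle X](take_size s); apply: H => //.
  by rewrite (leq_ltn_trans _ jk)// leq_add2r ltnW.
rewrite -sumrB (bigD1_seq j) ?mem_index_iota ?iota_uniq//=.
rewrite -[leLHS]addr0 lerD//; last first.
  apply: sumr_ge0 => l _; rewrite -mulrBr mulr_ge0// subr_ge0.
  rewrite ge_max !le_max lexx/= lerB ?orbT// ler_nat; exact: ltnW.
rewrite -mulrBr ler_peMr//.
have mk' : m%:R + 1 <= k%:R :> R by rewrite natr1 ler_nat.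
have jk' : (j + 2)%:R + 1 <= k%:R :> R by rewrite natr1 ler_nat.
rewrite [Num.max _ (k%:R - _)](_ : _ = k%:R - (j + 2)%:R); last first.
  by apply/max_idPr; rewrite subr_ge0; lra.
by rewrite /Num.max; case: ifP; lra.
Qed.

Lemma slope_continuous s : continuous (slope s : R -> R).
Proof.
apply: (continuous_big (x0 := 0 : R)); first exact: add_continuous.
move=> j _ t; apply: cvgM; first exact: cvg_cst.
apply: (@continuous_max R R (cst 0) (fun u => u - (j + 2)%:R) t).
  exact: cvg_cst.
by apply: cvgB; [exact: cvg_id|exact: cvg_cst].
Qed.

Lemma tent_continuous s : continuous (tent s : R -> R).
Proof.
move=> t; apply: (@continuous_max R R (cst 0)
  (fun u => 1 - `|4 * (2 ^+ pickle s * u) - 4|) t); first exact: cvg_cst.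
apply: cvgB; first exact: cvg_cst.
apply: cvg_norm; apply: cvgB; last exact: cvg_cst.
by apply: cvgM; [exact: cvg_cst|apply: cvgM; [exact: cvg_cst|exact: cvg_id]].
Qed.

Definition bump_fun s t : R := tent s (sin t) * growth s t.

Lemma bump_continuous s : continuous (bump_fun s : R -> R).
Proof.
move=> t; apply: cvgM.
  exact: (continuous_comp (@continuous_sin R t) (@tent_continuous s (sin t))).
exact: (continuous_comp (@slope_continuous s t) (@continuous_expR R (slope s t))).
Qed.

Definition bump s : Creal R := Creal_Sub (mem_set (@bump_continuous s) : _ \in @contp R).

Lemma bumpE s t : val (bump s) t = tent s (sin t) * growth s t.
Proof. by []. Qed.

Definition base s : R := asin (peak s).

(** Translates of [base s] by multiples of the period of the sine: the tent is at
    its full height there, while the growth factor has reached the level [k]. *)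
Definition point s k : R := base s + pi *+ 2 *+ k.+1.

Lemma peak_itv s : -1 <= peak s <= 1.
Proof.
have p0 : 0 < peak s by rewrite invr_gt0 exprn_gt0.
apply/andP; split; first by apply: le_trans (ltW p0); rewrite lerN10.
by rewrite invf_le1 ?exprn_gt0// exprn_ege1// ler1n.
Qed.

Lemma sin_base s : sin (base s) = peak s.
Proof. by rewrite asinK// in_itv/= peak_itv. Qed.

Lemma base_itv s : -2 <= base s <= 2.
Proof.
have := asin_lepi2 (peak_itv s); have := asin_geNpi2 (peak_itv s).
by have := pihalf_lt2 R; rewrite -/(base s); lra.
Qed.

Lemma sin_point s k : sin (point s k) = peak s.
Proof. by rewrite /point (periodicn (@sinD2pi R)) sin_base. Qed.

Lemma point_ge s k : k%:R <= point s k.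
Proof.
have /andP[b2 _] := base_itv s; rewrite /point -mulrnA -mulr_natr.
have : 2 * (2 * k.+1)%:R <= pi * (2 * k.+1)%:R :> R.
  by rewrite ler_wpM2r// pi_ge2.
by rewrite natrM -natr1; have : 0 <= k%:R :> R by []; lra.
Qed.

(** Here 10 and 8 come from [base s <= 2] and [pi <= 4]. *)
Lemma norm_point_le s k : `|point s k| <= (8 * k + 10)%:R.
Proof.
have /andP[b1 b2] := base_itv s; rewrite /point -mulrnA -mulr_natr.
have : pi * (2 * k.+1)%:R <= 4 * (2 * k.+1)%:R :> R.
  by rewrite ler_wpM2r//; have := pihalf_lt2 R; lra.
have := point_ge s k; rewrite /point -mulrnA -mulr_natr => H.
have k0 : 0 <= k%:R :> R by [].
rewrite ger0_norm; last exact: le_trans H.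
by rewrite natrM -natr1 natrD natrM; lra.
Qed.

Lemma bump_base s : val (bump s) (base s) = 1.
Proof.
have /andP[_ b2] := base_itv s.
by rewrite bumpE sin_base tent_peak /growth slope_eq0// expR0 mulr1.
Qed.

Lemma bump_ne s s' t : 0 < tent s (sin t) -> s' <> s -> val (bump s') t = 0.
Proof. by move=> su /(tent_eq0 su); rewrite bumpE => ->; rewrite mul0r. Qed.

Lemma growth_gt0 s t : 0 < growth s t.
Proof. exact: expR_gt0. Qed.

Lemma growth_mono s t u : t <= u -> growth s t <= growth s u.
Proof. by move=> tu; rewrite ler_expR slope_mono. Qed.

End Bump.

(** * The closed span of the functions indexed by a tree *)

Section TreeSpan.
Context {R : realType}.
Implicit Types (s : seq nat) (T : set (seq nat)).

Definition tree_seq T (n : nat) : Creal R :=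
  if unpickle n is Some s then (if `[< T s >] then bump s else 0) else 0.

(** Evaluations are linear and continuous, so that a linear relation between the
    values at two points passes from the generators to the closed span. *)
Lemma cspan_eval (g : nat -> Creal R) (f : Creal R) (a t u : R) :
  (forall n, val (g n) t = a * val (g n) u) -> cspan_set g f ->
  val f t = a * val f u.
Proof.
move=> gtu /cspan_setP gf.
have combE c : val (rat_comb g c) t = a * val (rat_comb g c) u.
  rewrite /rat_comb; elim: c => [|x c IH]; first by rewrite !big_nil mulr0.
  by rewrite !big_cons !Creal_addE !Creal_scaleE IH gtu mulrDr mulrCA.
apply/eqP; rewrite -subr_eq0 -normr_le0; apply/ler_addgt0Pr => e e0.
have [m tum] : exists m : nat, `|t| <= m%:R /\ `|u| <= m%:R.
  have [m tm] := norm_le_nat t; have [n un] := norm_le_nat u.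
  exists (maxn m n); split; [apply: le_trans tm _|apply: le_trans un _];
    by rewrite ler_nat (leq_maxl, leq_maxr).
have a1 : 0 < 1 + `|a| by rewrite ltr_pwDl.
have [|c fc] := gf m (e / (1 + `|a|)); first by rewrite divr_gt0.
rewrite add0r (_ : val f t - a * val f u =
    val (f - rat_comb g c) t - a * val (f - rat_comb g c) u); last first.
  by rewrite !(Creal_sub_scaleE 0) combE; lra.
apply: le_trans (ler_normB _ _) _; rewrite normrM.
apply: (@le_trans _ _ ((1 + `|a|) * cnorm m (f - rat_comb g c))).
  rewrite mulrDl mul1r lerD//; first exact: cnorm_ge tum.1.
  by rewrite ler_wpM2l//; exact: cnorm_ge tum.2.
by rewrite mulrC -ler_pdivlMr// ltW.
Qed.

Section Values.
Variables (T : set (seq nat)) (f : Creal R).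
Hypothesis Tf : cspan_set (tree_seq T) f.

Lemma tree_span_tent s t : 0 < tent s (sin t) ->
  val f t = val (bump s) t * val f (base s).
Proof.
move=> st; apply: cspan_eval Tf => n; rewrite /tree_seq.
case: (unpickle n) => [s'|]; last by rewrite mulr0.
case: asboolP => // _; last by rewrite mulr0.
have [->|/eqP s's] := eqVneq s' s; first by rewrite bump_base mulr1.
rewrite (bump_ne st s's) (@bump_ne _ s s' (base s)) ?mulr0//.
by rewrite sin_base tent_peak.
Qed.

Lemma tree_span_tent0 t : (forall s, tent s (sin t) = 0) -> val f t = 0.
Proof.
move=> t0; rewrite -(mul0r (val f t)); apply: cspan_eval Tf => n.
rewrite mul0r /tree_seq; case: (unpickle n) => // s.
by case: asboolP => // _; rewrite bumpE t0 mul0r.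
Qed.

Lemma tree_span_base s : ~ T s -> val f (base s) = 0.
Proof.
move=> nTs; rewrite -(mul0r (val f (base s))); apply: cspan_eval Tf => n.
rewrite mul0r /tree_seq; case: (unpickle n) => // s'; case: asboolP => // Ts'.
apply: (@bump_ne _ s); first by rewrite sin_base tent_peak.
by move=> s's; rewrite s's in Ts'.
Qed.

(** So the seminorms of an element of the closed span are comparable with weighted
    suprema of its values at the points [base s]. *)
Lemma tree_span_le (m : nat) t : `|t| <= m%:R -> val f t = 0 \/
  exists s, `|val f t| <= growth s m%:R * `|val f (base s)|.
Proof.
move=> tm; have [t0|/existsNP[s /eqP st]] := pselect (forall s, tent s (sin t) = 0).
  by left; exact: tree_span_tent0.
right; exists s; rewrite (@tree_span_tent s); last by rewrite lt_def st tent_ge0.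
rewrite normrM ler_wpM2r// bumpE normrM ger0_norm ?tent_ge0//.
rewrite gtr0_norm ?growth_gt0//.
apply: (@le_trans _ _ (1 * growth s t)).
  by rewrite ler_wpM2r ?tent_le1// ltW// growth_gt0.
by rewrite mul1r growth_mono// (le_trans (ler_norm t)).
Qed.

Lemma tree_span_ge s (k : nat) :
  growth s k%:R * `|val f (base s)| <= cnorm (8 * k + 10) f.
Proof.
apply: le_trans (cnorm_ge f (norm_point_le s k)).
rewrite (@tree_span_tent s (point s k)); last by rewrite sin_point tent_peak.
rewrite normrM ler_wpM2r// bumpE sin_point tent_peak mul1r.
by rewrite gtr0_norm ?growth_gt0// growth_mono// point_ge.
Qed.

End Values.

Lemma tree_span_bump T s : T s -> cspan_set (tree_seq T) (bump s).
Proof.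
move=> Ts; have := @cspan_gen R (tree_seq T) (pickle s).
by rewrite /tree_seq pickleK; case: asboolP.
Qed.

(** Along a branch of the tree the initial segments of each given length are all
    the same, so that the corresponding functions are bounded. *)
Lemma branch_not_montel T (x : nat -> nat) : (forall n, T (mkseq x n)) ->
  ~ montel_space (subspace_type (cspan (tree_seq T))).
Proof.
move=> Tx; apply/not_montel_subspaceP.
pose b n : R := \sum_(0 <= j < n) (pickle (mkseq x j))%:R * n%:R.
exists (fun i => bump (mkseq x i)), (fun n => (Num.truncn (expR (b n))).+2).
split=> [i|n i|i j ij].
- exact: tree_span_bump.
- apply: cnorm_le => t tn.
  rewrite bumpE normrM ger0_norm ?tent_ge0// gtr0_norm ?growth_gt0//.
  apply: (@le_trans _ _ (growth (mkseq x i) t)).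
    by rewrite ler_piMl ?tent_le1// ltW// growth_gt0.
  apply: (@le_trans _ _ (expR (b n))).
    by rewrite ler_expR slope_le// (le_trans (ler_norm t)).
  by apply: le_trans (ltW (truncnS_gt _)) _; rewrite ler_nat.
- set s := mkseq x i; set M := (Num.truncn _).+2.
  have sM : `|base s : R| <= M%:R.
    apply: (@le_trans _ _ 2); first by rewrite ler_norml base_itv.
    by rewrite ler_nat.
  apply: le_trans (cnorm_ge _ sM).
  rewrite (Creal_sub_scaleE 0) bump_base (@bump_ne _ s) ?subr0 ?normr1//.
    by rewrite sin_base tent_peak.
  by move=> /(congr1 size); rewrite !size_mkseq => /esym.
Qed.

End TreeSpan.

(** * Non-Montel spans come from infinite branches *)

(** Koenig's lemma: an initial segment that is shared by infinitely many members
    of [I] has an extension by one term with the same property, because it has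
    finitely many such extensions. *)
Lemma finitely_branching_branch (T I : set (seq nat)) :
  (forall s n, T s -> T (take n s)) -> I `<=` T -> infinite_set I ->
  (forall j, finite_set [set take j s | s in I]) ->
  exists x : nat -> nat, forall n, T (mkseq x n).
Proof.
move=> Ttake IT infI finI.
pose above (u : seq nat) := [set s | I s /\ take (size u) s = u].
have /choice[F HF] : forall u : seq nat, exists a,
    infinite_set (above u) -> infinite_set (above (rcons u a)).
  move=> u; apply: contrapT => /forallNP nF.
  have [infu finr] : infinite_set (above u) /\
      forall a, finite_set (above (rcons u a)).
    split=> [|a].
      by apply: contrapT => finu; apply: (nF 0%N).
    by apply: contrapT => infa; apply: (nF a).
  apply: infu; pose n := size u.
  pose D := [set take n.+1 s | s in I].
  have : finite_set ([set u] `|` \bigcup_(v in D)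
      [set s | I s /\ exists2 a, v = rcons u a & take n.+1 s = rcons u a]).
    rewrite finite_setU; split=> //; apply: bigcup_finite; first exact: finI.
    move=> v _; have [[a va]|nva] := pselect (exists a, v = rcons u a).
      apply: sub_finite_set (finr a) => s [Is [b vb sb]]; split => //.
      by rewrite size_rcons sb -vb.
    apply: sub_finite_set (@finite_set0 _) => s [_ [b vb _]].
    by apply: nva; exists b.
  apply: sub_finite_set => s [Is su]; have [sn|ns] := leqP (size s) n.
    by left; rewrite -su /= take_oversize.
  right; exists (take n.+1 s); first by exists s.
  split=> //; exists (nth 0%N s n); last by rewrite (take_nth 0%N ns) su.
  by rewrite (take_nth 0%N ns) su.
pose U n := iter n (fun u => rcons u (F u)) [::].
exists (fun n => F (U n)) => n.
have -> : mkseq (fun n => F (U n)) n = U n.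
  by elim: n => // n IH; rewrite mkseqS IH.
have : infinite_set (above (U n)).
  elim: n => [|n IH]; last exact: HF.
  apply: sub_infinite_set infI => s Is; split => //.
  by rewrite /= take0.
move=> /infinite_setN0[s [Is <-]]; exact/Ttake/IT.
Qed.

Lemma pigeonhole (F : finType) (f : nat -> F) : exists i j, i <> j /\ f i = f j.
Proof.
apply: contrapT => /forallNP nf.
have finj : injective (fun i : 'I_#|F|.+1 => f i).
  move=> i j fij; apply: val_inj; apply: contrapT => ij.
  by have /forallNP/(_ (val j)) := nf (val i); apply.
by have := leq_card _ finj; rewrite card_ord ltnn.
Qed.

Section Converse.
Context {R : realType}.

(** This is the pigeonhole principle for the rounded coordinates. *)
Lemma bounded_close (s : seq (seq nat)) (a : nat -> seq nat -> R) (M e : R) :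
  0 < e -> (forall i u, u \in s -> `|a i u| <= M) ->
  exists i j, i <> j /\ forall u, u \in s -> `|a i u - a j u| < e.
Proof.
move=> e0 aM.
pose B := Num.truncn ((M + M) / e).
pose q i u := Num.truncn ((a i u + M) / e).
have q0 i u : u \in s -> 0 <= (a i u + M) / e.
  move=> us; rewrite divr_ge0 ?(ltW e0)//.
  by have := aM i u us; rewrite ler_norml => /andP[]; lra.
have qB i u : u \in s -> (q i u < B.+1)%N.
  move=> us; rewrite ltnS; apply: le_truncn; rewrite ler_pM2r ?invr_gt0// lerD2r.
  exact: le_trans (ler_norm _) (aM i u us).
have [i [j [ij fij]]] := @pigeonhole {ffun 'I_(size s) -> 'I_B.+1}
  (fun i => [ffun k : 'I_(size s) => inord (q i (nth [::] s k))]).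
exists i, j; split=> // u us.
have qij : q i u = q j u.
  have us' : (index u s < size s)%N by rewrite index_mem.
  move: fij => /ffunP/(_ (Ordinal us')); rewrite !ffunE /= nth_index//.
  by move=> /(congr1 val); rewrite /= !inordK// qB.
have /andP[i1 i2] := truncn_itv (q0 i u us).
have /andP[j1 j2] := truncn_itv (q0 j u us).
move: i1 i2 j1 j2; rewrite -/(q i u) -/(q j u) qij -natr1.
rewrite !ler_pdivlMr// !ltr_pdivrMr// mulrDl mul1r => i1 i2 j1 j2.
by rewrite ltr_norml; apply/andP; split; lra.
Qed.

(** If only finitely many coordinates were large for the seminorm of index [m]
    that separates the sequence, then two terms would be close to each other by the
    pigeonhole principle. For the infinitely many large ones, the boundedness of
    the sequence bounds the ratio of the growths at [k] and [m], hence the codes of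
    the [j]-th initial segments as soon as [k] is large. *)
Lemma not_montel_branch (T : set (seq nat)) :
  (forall s n, T s -> T (take n s)) ->
  ~ montel_space (subspace_type (cspan (@tree_seq R T))) ->
  exists x : nat -> nat, forall n, T (mkseq x n).
Proof.
move=> Ttake /not_montel_subspaceP[f [M [Tf fM fsep]]].
pose m := M 0%N; pose a i s := growth s m%:R * val (f i) (base s).
have aE i s : `|a i s| = growth s m%:R * `|val (f i) (base s)|.
  by rewrite normrM gtr0_norm// growth_gt0.
have aM i s : `|a i s| <= (M (8 * m + 10)%N)%:R.
  by rewrite aE; apply: le_trans (fM _ i); exact: tree_span_ge (Tf i) s m.
(* two terms whose coordinates are all smaller than 1/4 would be closer to each
     other than 1/2 *)
pose I := [set s | exists i, 4^-1 <= `|a i s|].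
apply: (@finitely_branching_branch T I) => //.
- move=> s [i ai]; apply: contrapT => nTs; move: ai.
  by rewrite aE (tree_span_base (Tf i) nTs) normr0 mulr0 leNgt invr_gt0 ltr0n.
- move=> /finite_seqP[l Il].
  have [|i [j [ij aij]]] := @bounded_close l a _ 2^-1 _ (fun i u _ => aM i u).
    by rewrite invr_gt0.
  have := fsep i j ij; rewrite leNgt => /negP; apply.
  apply: (@le_lt_trans _ _ 2^-1); last by rewrite invf_lt1 ?ltr1n.
  apply: cnorm_le => t tm.
  have Tfij : cspan_set (tree_seq T) (f i - f j).
    have [_ TD] := @subspace_submod _ _ (cspan (@tree_seq R T)).
    rewrite addrC -scaleN1r; apply/set_mem/TD; apply/mem_set; exact: Tf.
  have [->|[s fs]] := tree_span_le Tfij tm; first by rewrite normr0 invr_ge0.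
  apply: le_trans fs _; rewrite (Creal_sub_scaleE 0).
  rewrite -[growth s _]gtr0_norm ?growth_gt0// -normrM mulrBr -/(a i s) -/(a j s).
  have [Is|nIs] := pselect (I s).
    by apply/ltW/aij; have : [set` l] s by rewrite -Il.
  have small k : `|a k s| < 4^-1 by rewrite ltNge; apply/negP => ak; apply: nIs; exists k.
  by apply: le_trans (ler_normB _ _) _; have := small i; have := small j; lra.
- move=> j; pose k := maxn m.+1 (j + 3).
  have mk : (m < k)%N by exact: leq_maxl.
  have jk : (j + 2 < k)%N by rewrite -addnS leq_maxr.
  pose C : R := 4 * (M (8 * k + 10)%N)%:R.
  apply: (@sub_finite_set _ _ [set s | (pickle s < (Num.truncn C).+1)%N]); last first.
    apply: (finite_preimage (B := `I_(Num.truncn C).+1)) => //.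
    by move=> s s' _ _; exact: (pcan_inj pickleK).
  move=> _ [s [i ai] <-] /=; rewrite -(ltr_nat R).
  apply: le_lt_trans (truncnS_gt C).
  apply: le_trans (slope_increase s mk jk) _.
  apply: (@le_trans _ _ (expR (slope s k%:R - slope s m%:R))).
    by apply: le_trans (expR_ge1Dx _); rewrite lerDr.
  rewrite expRB -/(growth s k%:R) -/(growth s m%:R) ler_pdivrMr ?growth_gt0//.
  have := le_trans (tree_span_ge (Tf i) s k) (fM _ i).
  rewrite /C; move: ai; rewrite aE.
  have Gm0 := @growth_gt0 R s m%:R; have Gk0 := @growth_gt0 R s k%:R.
  move: Gm0 Gk0; move: (growth s m%:R) (growth s k%:R) `|val (f i) (base s)| => Gm Gk x Gm0 Gk0 xm xk.
  have Mx : Gk * x * Gm <= (M (8 * k + 10)%N)%:R * Gm by rewrite ler_wpM2r// ltW.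
  have : Gk * 4^-1 <= Gk * (Gm * x) by rewrite ler_wpM2l// ltW.
  by move: Mx; rewrite mulrAC -[Gk * Gm * x]mulrA; lra.
Qed.

(** The complement of [B] is the set of the parameters [z] for which the tree
    [T z] has an infinite branch. A given rational combination involves finitely
    many functions only, hence finitely many closed conditions on [z]; the
    induction on the combination runs over all sets [U], because it replaces [U] by
    its translates. *)
Lemma montel_hard : pi11_hard R (Mon R).
Proof.
move=> Z pZ B /(analytic_suslin pZ)/suslin_decreasing[F [clF decF BF]].
pose T z : set (seq nat) := [set s | F s z].
exists (fun z => cspan (tree_seq (T z))).
  apply: borel_map_cspan => c U _; elim: c U => [|x c IH] U.
    have [U0|U0] := pselect (U (0 : Creal R)).
      rewrite (_ : [set z | _] = setT); first by apply: borel_open; exact: openT.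
      by apply/seteqP; split=> // z _; rewrite /= /rat_comb big_nil.
    rewrite (_ : [set z | _] = set0); first by apply: borel_open; exact: open0.
    by apply/seteqP; split=> // z; rewrite /= /rat_comb big_nil.
  pose P (h : Creal R) := [set z | U (ratr x.1 *: h + rat_comb (tree_seq (T z)) c)].
  have bP h : borel (P h) by exact: (IH [set v | U (ratr x.1 *: h + v)]).
  case xs : (unpickle x.2) => [s|]; last first.
    rewrite (_ : [set z | _] = P 0)//; apply: eq_set => z.
    by rewrite /rat_comb big_cons {1}/tree_seq xs.
  rewrite (_ : [set z | _] = (F s `&` P (bump s)) `|` (~` F s `&` P 0)).
    by apply: borelU; apply: borelI => //; [|apply: borelC]; exact: borel_closed.
  apply/seteqP; split=> z; rewrite /= /rat_comb big_cons {1}/tree_seq xs;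
    case: asboolP => Fs; rewrite /P/= /rat_comb.
  - by left.
  - by right.
  - by case=> -[].
  - by case=> -[].
apply/seteqP; split=> z /=.
  move=> mT; apply: contrapT => /BF[x xF]; apply: branch_not_montel mT => n.
  exact: xF.
move=> Bz; apply: contrapT => /not_montel_branch.
move=> [s n|x xF]; first exact: decF.
have : (~` B) z by apply/BF; exists x.
exact.
Qed.

End Converse.

(** * A coanalytic set that is not Suslin *)

Section Diagonal.
Variable R : realType.

(** Read as a set of pairs of finite sequences, a point [z] of the Baire space
    codes a Suslin set; [diagonal] is the set of the points that belong to the set
    that they code. *)
Definition diagonal_witness (z x : nat -> nat) :=
  forall n, z (pickle (mkseq z n, mkseq x n)) = 0%N.

Definition diagonal : set (baire R) :=
  [set z : nat -> nat | exists x, diagonal_witness z x].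

Definition diagonal_dist := power_dist (discrete_dist R (nat * nat)%type).

Definition diagonal_graph : set (nat -> nat * nat) :=
  [set w | diagonal_witness (fst \o w) (snd \o w)].

Lemma diagonal_polish_psm : polish_psm (sub_dist diagonal_dist (S := diagonal_graph)).
Proof.
apply: sub_polish; first exact/power_polish/discrete_polish.
move=> w clw n.
have /choice[K HK] := pball_power_coord (discrete_dist R (nat * nat)%type) 0.
pose N := pickle (mkseq (fst \o w) n, mkseq (snd \o w) n).
have [w' w'P ww'] := clw (maxn (K N) (\max_(i < n) K i)).
have EN : w N = w' N.
  by apply/(@discrete_pballE R _ 0)/HK; apply: pball_le ww'; exact: leq_maxl.
have Ei i : (i < n)%N -> w i = w' i.
  move=> ik; apply/(@discrete_pballE R _ 0)/HK; apply: pball_le ww'.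
  rewrite leq_max; apply/orP; right.
  exact: (leq_bigmax (F := fun i : 'I_n => K i) (Ordinal ik)).
have mkE (p : nat * nat -> nat) : mkseq (p \o w) n = mkseq (p \o w') n.
  apply: (@eq_from_nth _ 0%N); rewrite ?size_mkseq// => i ik.
  by rewrite !nth_mkseq//= Ei.
have := w'P n; rewrite -!mkE -/N => <-.
by rewrite /= EN.
Qed.

Definition diagonal_psmSpace : psmSpace R :=
  PsmSpace (let: And4 h _ _ _ := diagonal_polish_psm in h).

Lemma diagonal_analytic : polish_analytic R diagonal.
Proof.
exists (psm_type diagonal_psmSpace); first exact/polish_psm_type/diagonal_polish_psm.
exists (fun w : psm_type diagonal_psmSpace => fst \o sval w).
  apply: (@psm_continuous R (psm_type diagonal_psmSpace) (baire R) _ _ _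
    (@psm_type_generates R diagonal_psmSpace)
    (@psm_type_generates R (baire_psmSpace R))).
  move=> m; have [k Hk] := pball_power (discrete_dist R nat) m.
  have /choice[K HK] := pball_power_coord (discrete_dist R (nat * nat)%type) 0.
  exists (\max_(i < k.+1) K i) => x y xy; apply: Hk => i ik.
  apply/discrete_pballE; rewrite /=; congr fst.
  apply/(@discrete_pballE R _ 0)/HK; apply: pball_le xy.
  exact: (leq_bigmax (F := fun i : 'I_k.+1 => K i) (Ordinal (ik : (i < k.+1)%N))).
apply/seteqP; split=> [_ [[w wP] _ <-]|z [x zx]]; first by exists (snd \o w).
by exists (exist _ (fun n => (z n, x n)) zx).
Qed.

(** A Suslin description of the complement would be coded by a point [z] of the
    Baire space, which could neither belong to [diagonal] nor to its complement. *)
Lemma diagonalC_not_suslin : ~ suslin (~` diagonal).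
Proof.
move=> /suslin_decreasing[F [clF decF HF]].
pose meets (s t : seq nat) := exists2 y : nat -> nat,
  mkseq y (size s) = s & F t (y : baire R).
pose z n := if unpickle n is Some st then
  (if `[<meets st.1 st.2>] then 0%N else 1%N) else 1%N.
have zE s t : z (pickle (s, t)) = 0%N <-> meets s t.
  by rewrite /z pickleK/=; case: asboolP.
have zP : diagonal (z : baire R) <-> exists x : nat -> nat, forall n, F (mkseq x n) (z : baire R).
  split=> -[x Hx]; exists x => n.
    apply: clF => A /baire_nbhsP[m zA].
    have /zE[y yz Fy] := Hx (maxn m n); rewrite size_mkseq in yz.
    exists y; split.
      have := decF _ n _ Fy; rewrite take_mkseq ?leq_maxr//.
    apply: zA; have := congr1 (take m) yz.
    by rewrite !take_mkseq ?leq_maxl.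
  by apply/zE; exists z; rewrite ?size_mkseq.
have [zD|zD] := pselect (diagonal (z : baire R)).
  by have := HF z; rewrite -zP => /iffRL /(_ zD).
by have /HF/zP := zD.
Qed.

End Diagonal.

(** The preimage of an analytic set of closed subspaces under a Borel map is
    Suslin: it is the projection of a set of pairs that is described by countably
    many Borel conditions, because two closed subspaces that hit the same basic
    open sets are equal. *)
Lemma analytic_preimage_suslin (R : realType) (Z : topologicalType)
    (A : set (SF R)) (g : Z -> SF R) :
  polish R Z -> analytic R A -> borel_map g -> suslin (g @^-1` A).
Proof.
move=> [_ [dZ [metZ _]]] [Y pY [f bf <-]] bg.
have [_ [dY [metY _]]] := pY.
pose H i : set (SF R) :=
  [set X : closed_subspace (Creal R) | (X : set _) `&` creal_base R i !=set0].
have mH i : measurable (H i).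
  apply: sub_sigma_algebra; exists (creal_base R i) => //; exact: creal_base_open.
have sf i : suslin ((f @^-1` H i) : set Y) /\ suslin (~` (f @^-1` H i) : set Y).
  by split; apply: (borel_suslin metY); [|apply: borelC]; exact: bf.
have sg i : suslin ((g @^-1` H i) : set Z) /\ suslin (~` (g @^-1` H i) : set Z).
  by split; apply: (borel_suslin metZ); [|apply: borelC]; exact: bg.
pose C : set (Y * Z) := \bigcap_i (
  (fst @^-1` (f @^-1` H i) `&` snd @^-1` (g @^-1` H i)) `|`
  (fst @^-1` (~` (f @^-1` H i)) `&` snd @^-1` (~` (g @^-1` H i)))).
have cfst : continuous (fst : Y * Z -> Y) by move=> p; exact: cvg_fst.
have csnd : continuous (snd : Y * Z -> Z) by move=> p; exact: cvg_snd.
have sC : suslin C.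
  apply: suslin_bigcap => i; have [sf1 sf2] := sf i; have [sg1 sg2] := sg i.
  by apply: suslinU; apply: suslinI; exact: suslin_preimage.
have := suslin_projection pY sC.
rewrite (_ : [set z | _] = g @^-1` range f)//; apply/seteqP; split=> z.
  move=> [y Cyz]; exists y => //; apply: closed_subspace_eq => i.
  by have [[]|[]] := Cyz i Logic.I.
move=> [y _ fy]; exists y => i _ /=.
by have [Hi|Hi] := pselect (H i (g z)); [left|right]; rewrite fy.
Qed.

Lemma hard_not_analytic (R : realType) (A : set (SF R)) :
  pi11_hard R A -> ~ analytic R A.
Proof.
move=> hA aA.
have [|g bg gA] := hA _ (baire_polish R) (~` diagonal (R := R)).
  by rewrite /polish_coanalytic setCK; exact: diagonal_analytic.
apply: (@diagonalC_not_suslin R); rewrite -gA.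
exact: analytic_preimage_suslin (baire_polish R) aA bg.
Qed.

Theorem theorem4p28 (R : realType) :
  complete_coanalytic R (Mon R) /\ ~ analytic R (Mon R).
Proof.
have hardMon := @montel_hard R.
by split; [split; [exact: montel_coanalytic|]|exact: hard_not_analytic].
Qed.
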